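(* Let $0<a<b$, $n\in\mathbb{N}$, let $\alpha_0,\dots,\alpha_n\in\mathbb{R}$ be real numbers with $\alpha_0<\alpha_1<\dots<\alpha_n$, and let $\mathcal{F}=\{f_i\}_{i=0}^n$ with $f_i(x)=x^{\alpha_i}$. Let $f\in\operatorname{lin}\mathcal{F}$ with $f\ge 0$ on $[a,b]$. Then there exist points $x_1,\dots,x_n,y_1,\dots,y_n\in[a,b]$ (not necessarily distinct) with $y_n=b$ which include the zeros of $f$ with multiplicities, and there exist constants $c_*,c^*\in\mathbb{R}$ such that $$f=f_*+f^*$$ with $f_*,f^*\in\operatorname{lin}\mathcal{F}$, $f_*,f^*\ge 0$ on $[a,b]$, and the polynomials $f_*$ and $f^*$ are given by $$f_*(x)=c_*\cdot\det\left(\begin{array}{c|ccc} f_0&f_1&\dots&f_n\\ x&x_1&\dots&x_n\end{array}\right)\qquad\text{and}\qquad f^*(x)=c^*\cdot\det\left(\begin{array}{c|ccc} f_0&f_1&\dots&f_n\\ x&y_1&\dots&y_n\end{array}\right)$$ for all $x\in[a,b]$. Removing the zeros of $f$ from $x_1,\dots,x_n,y_1,\dots,y_n$, we can assume that the remaining $x_i$ and $y_i$ are disjoint and, when grouped by size, the groups strictly interlace: $$a\ \le\ x_{i_1}=\dots=x_{i_k}\ <\ y_{j_1}=\dots=y_{j_l}\ <\ \dots\ <\ x_{i_p}=\dots=x_{i_q}\ <\ y_{j_r}=\dots=y_{j_s}=b.$$ Each such group in $(a,b)$ has an even number of members.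
   Context: $\operatorname{lin}\mathcal{F}$ is the real vector space of linear combinations of the functions in $\mathcal{F}$; its elements are called polynomials. For points $z_1,\dots,z_n$ (arranged in non-decreasing order, repeated according to multiplicity), $\left(\begin{array}{c|ccc} f_0&f_1&\dots&f_n\\ x&z_1&\dots&z_n\end{array}\right)$ is the $(n+1)\times(n+1)$ matrix whose first row is $(f_0(x),\dots,f_n(x))$ and which, for every value $z$ occurring exactly $k$ times among $z_1,\dots,z_n$, contains the $k$ consecutive rows $(f_0^{(j)}(z),\dots,f_n^{(j)}(z))$, $j=0,\dots,k-1$ (derivatives of order $j$).
   Formalization: The chain may also start with a y-group at a (the displayed x-first chain fails for f=1, exponents 0,1,2 on [1,2]); clauses on zeros assume f is not identically 0; if f has n zeros, none at b, only the x_i include them and c^*=0; if all points are zeros the chain is empty. *)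

(* Defs.v *)
From mathcomp Require Import all_boot all_order all_algebra.
From mathcomp Require Import all_classical all_reals all_analysis.
Import Order.TTheory GRing.Theory Num.Theory.
Import numFieldNormedType.Exports.

Set Implicit Arguments.
Unset Strict Implicit.
Unset Printing Implicit Defensive.

Local Open Scope ring_scope.
Local Open Scope classical_set_scope.

Definition lin (R : realType) (n : nat) (F : 'I_n -> R -> R) : set (R -> R) :=
  [set f | exists c : 'I_n -> R, f = fun t => \sum_(i < n) c i * F i t].

(* Row k >= 1 carries the derivatives at z_k of order #{l < k : z_l = z_k}; for
   z in non-decreasing order, a value occurring k times thus gives the k
   consecutive rows of derivatives of order 0, ..., k - 1. *)
Definition osc_mx (R : realType) (n : nat) (F : 'I_n.+1 -> R -> R) (t : R)
    (z : n.-tuple R) : 'M[R]_(1 + n) :=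
  col_mx (\row_(j < n.+1) F j t)
         (\matrix_(k < n, j < n.+1)
            derive1n (count_mem (tnth z k) (take k z)) (F j) (tnth z k)).

Definition zero_order (R : realType) (f : R -> R) (z : R) (k : nat) : Prop :=
  (forall j, (j < k)%N -> derive1n j f z = 0) /\ derive1n k f z != 0.

(* Z lists the zeros of f in [a, b], each repeated according to its
   multiplicity; no such Z exists when f vanishes identically. *)
Definition zeros_with_mult (R : realType) (a b : R) (f : R -> R) (Z : seq R)
    : Prop :=
  (forall z, z \in Z -> a <= z <= b) /\
  (forall z, a <= z <= b -> zero_order f z (count_mem z Z)).

Definition includes_mult (T : eqType) (Z s : seq T) : Prop :=
  forall z, (count_mem z Z <= count_mem z s)%N.

(* Multiset difference: one occurrence is removed for each entry of Z. *)
Definition mdiff (T : eqType) (s Z : seq T) : seq T :=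
  foldr (fun z u => rem z u) s Z.

(* g lists the groups of equal points from left to right, (z, false) standing
   for the group of the x_i equal to z and (z, true) for that of the y_i.
   Strict increase of the locations makes xs and ys disjoint.
   The leftmost group need not be an x-group: on [1, 2] the decomposition of
   the constant 1 in lin {1, t, t^2} has x_1 = x_2 = 3/2, y_1 = 1, y_2 = 2.  A
   y-group on the far left is allowed at a only (unless there is no x-group). *)
Definition strictly_interlace (R : realType) (a b : R) (xs ys : seq R) : Prop :=
  exists g : seq (R * bool),
    [/\ (forall z, ((z, false) \in g) = (z \in xs)),
        (forall z, ((z, true) \in g) = (z \in ys)),
        sorted (fun p q : R * bool => (p.1 < q.1) && (p.2 != q.2)) g,
        last (b, true) g = (b, true) &
        xs != [::] ->
          (head (a, true) g).2 = false \/ head (a, true) g = (a, true)].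

Definition even_groups_inside (R : realType) (a b : R) (s : seq R) : Prop :=
  forall z, a < z < b -> ~~ odd (count_mem z s).

(* Main.v *)
Require Import Defs.
From mathcomp Require Import all_boot all_order all_algebra.
From mathcomp Require Import all_classical all_reals all_analysis.
From mathcomp Require Import ring lra zify.
Import Order.TTheory GRing.Theory Num.Theory.
Import numFieldNormedType.Exports.

(** A nonzero element of lin F has at most [n] zeros on the positive half-line,
    counted with multiplicities ([zero_count], by Rolle).  Hence [n] prescribed
    zeros determine an element up to a factor, namely the determinant
    ([vanish_osc_det]); such an element exists, has no further zeros, and its
    sign changes are known ([prescribed_zeros], [nsign_const]).

    Let [Z] list the zeros of [f] in [a, b], and let [m = n - size Z] be
    positive; for [m = 0] the function [f] is itself a determinant.  Among all
    [p] with [0 <= p <= f] on [a, b], which form a compact set, take one with the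
    largest value at a point [c > b], up to a sign depending on the order of [f]
    at [b] ([extremal_between]).  The decomposition is [f = p + (f - p)].

    Every such [p] vanishes on [Z].  Call a point of [a, b] a lower contact if
    [p], and an upper contact if [f - p], has there a zero of higher order than
    [f].  If [q] vanishes on [Z] and has, relative to [f], positive sign at lower
    and negative sign at upper contacts, then [p + x q] stays between [0] and [f]
    for small [x > 0] ([perturb_between]).  If [m] points were enough to separate
    lower from upper contacts, with [c] treated as a lower contact, then a [q]
    with zeros in [Z] and in these points would increase [p] at [c]
    ([no_separators]).  So there are at least [m + 1] changes of kind when one
    runs through the contacts up to [c], and in particular at least [m + 1]
    contacts.

    Conversely, by nonnegativity a contact inside the interval adds two zeros to
    those in [Z], and one at an end point adds one ([contacts_vanish]).  The zero
    bound for [p] and for [f - p] leaves room for [m] additional zeros each, so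
    there are at most [m + 1] contacts, and equality requires both end points.
    Comparing the two estimates, there are exactly [m + 1] contacts, they
    alternate, [a] and [b] are among them, [b] is an upper one, and both
    summands have exactly [n] zeros in [a, b] ([snake_decomposition]).  The
    zeros added to those of [f] are double inside the interval and simple at the
    ends, whence the parity of the groups. *)

Set Implicit Arguments.
Unset Strict Implicit.
Unset Printing Implicit Defensive.

Local Open Scope ring_scope.
Local Open Scope classical_set_scope.

(** * Generalized polynomials and their zeros *)

Section GeneralizedPolynomials.
Context {R : realType} {N : nat}.
Implicit Types (al c : 'I_N -> R) (s t z : R) (j k : nat) (P : {poly R}).

Definition falling_poly j : {poly R} := \prod_(l < j) ('X - l%:R%:P).

(** The [j]-th derivative at [t > 0] of the sum of the [c i * t `^ al i].  A
    closed formula keeps all derivatives linear in [c] and total in [t]. *)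
Definition gpoly al c j t : R :=
  \sum_(i < N) c i * ((falling_poly j).[al i] * t `^ (al i - j%:R)).

(** [P(theta)] applied to the sum of the [c i * t `^ al i], where
    [theta = t d/dt] is the Euler operator, which is diagonal on powers. *)
Definition euler_form al c t P : R := \sum_(i < N) c i * (P.[al i] * t `^ al i).

Lemma falling_polyS j : falling_poly j.+1 = falling_poly j * ('X - j%:R%:P).
Proof. by rewrite /falling_poly big_ord_recr. Qed.

Lemma size_falling_poly j : size (falling_poly j) = j.+1.
Proof. by rewrite /falling_poly size_prod_XsubC /index_enum -enumT size_enum_ord. Qed.

Lemma falling_poly_monic j : falling_poly j \is monic.
Proof. by rewrite /falling_poly; apply: monic_prod_XsubC. Qed.

Lemma gpolyE al c t : gpoly al c 0 t = \sum_(i < N) c i * t `^ al i.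
Proof.
by apply: eq_bigr => i _; rewrite /falling_poly big_ord0 hornerC mul1r subr0.
Qed.

Lemma gpoly_lin al c c' (x : R) j t :
  gpoly al (fun i => c i + x * c' i) j t = gpoly al c j t + x * gpoly al c' j t.
Proof. by rewrite mulr_sumr -big_split; apply: eq_bigr => i _ /=; ring. Qed.

Lemma gpolyB al c c' j t :
  gpoly al (fun i => c i - c' i) j t = gpoly al c j t - gpoly al c' j t.
Proof. by rewrite -sumrB; apply: eq_bigr => i _ /=; ring. Qed.

Lemma gpolyZ al c (x : R) j t :
  gpoly al (fun i => x * c i) j t = x * gpoly al c j t.
Proof. by rewrite mulr_sumr; apply: eq_bigr => i _ /=; ring. Qed.

Lemma gpoly0 al j t : gpoly al (fun=> 0) j t = 0.
Proof. by rewrite /gpoly big1 // => i _; rewrite mul0r. Qed.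

Lemma is_derive_sumf (g : 'I_N -> R -> R) (dg : 'I_N -> R) t :
  (forall i, is_derive t 1 (g i) (dg i)) ->
  is_derive t 1 (fun u => \sum_(i < N) g i u) (\sum_(i < N) dg i).
Proof.
move=> dgP; rewrite (_ : (fun _ => _) = \sum_(i < N) g i); last first.
  by apply/funext => u; rewrite fct_sumE.
exact: is_derive_sum.
Qed.

Lemma is_derive_gpoly al c j t : 0 < t ->
  is_derive t 1 (gpoly al c j) (gpoly al c j.+1 t).
Proof.
move=> t0; apply: is_derive_sumf => i.
have H := is_derive1_powR (al i - j%:R) t0.
have := is_deriveZ (c i * (falling_poly j).[al i]) H.
set g := (X in is_derive _ _ X _); set d := (X in is_derive _ _ _ X -> _).
rewrite (_ : g =
    fun u => c i * ((falling_poly j).[al i] * u `^ (al i - j%:R))); last first.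
  by apply/funext => u; rewrite /g /= /GRing.scale /= mulrA.
rewrite (_ : d = c i * ((falling_poly j.+1).[al i] * t `^ (al i - j.+1%:R))) //.
rewrite /d /GRing.scale /= falling_polyS hornerM hornerXsubC -natr1 opprD addrA; ring.
Qed.

Lemma derive1n_gpoly al c j t : 0 < t -> derive1n j (gpoly al c 0) t = gpoly al c j t.
Proof.
elim: j t => [|j IH] t t0; first by [].
rewrite derive1nS derive1E -(@derive_val _ _ _ _ _ _ _ (is_derive_gpoly al c j t0)).
apply: near_eq_derive.
by near=> u; apply: IH; near: u; apply: lt_nbhsr.
Unshelve. all: by end_near.
Qed.

Lemma gpoly_continuous al c j t : 0 < t -> {for t, continuous (gpoly al c j)}.
Proof.
move=> t0; apply: differentiable_continuous; apply/derivable1_diffP.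
exact: (@ex_derive _ _ _ _ _ _ _ (is_derive_gpoly al c j t0)).
Qed.

Lemma gpoly_euler al c j t : 0 < t ->
  gpoly al c j t = t `^ (- j%:R) * euler_form al c t (falling_poly j).
Proof.
move=> t0; rewrite mulr_sumr; apply: eq_bigr => i _.
rewrite powRD; last by rewrite (gt_eqF t0) implybT.
ring.
Qed.

Lemma euler_formD al c t P Q :
  euler_form al c t (P + Q) = euler_form al c t P + euler_form al c t Q.
Proof. by rewrite -big_split; apply: eq_bigr => i _; rewrite hornerD /=; ring. Qed.

Lemma euler_formZ al c t x P : euler_form al c t (x *: P) = x * euler_form al c t P.
Proof. by rewrite mulr_sumr; apply: eq_bigr => i _; rewrite hornerZ; ring. Qed.

(** Orders of vanishing can be read off from [theta] as well as from [d/dt]: the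
    [j]-th derivative is [t `^ - j] times the falling factorial of [theta], and
    falling factorials form a triangular basis of the polynomials.  With
    [theta], changing a coefficient vector by a factor [al i - al i0] costs one
    order of vanishing, with no Leibniz rule. *)
Lemma vanish_euler_form al c k z : 0 < z ->
  (forall j, (j < k)%N -> gpoly al c j z = 0) ->
  forall P, (size P <= k)%N -> euler_form al c z P = 0.
Proof.
move=> z0; elim: k => [|k IH] H P.
  rewrite leqn0 size_poly_eq0 => /eqP ->.
  by rewrite /euler_form big1 // => i _; rewrite horner0 mul0r mulr0.
move=> sP.
have -> : P = (P - P`_k *: falling_poly k) + P`_k *: falling_poly k by rewrite subrK.
rewrite euler_formD euler_formZ IH; [|by move=> j jk; apply: H; apply: ltnW|].
- move: (H k (ltnSn k)); rewrite gpoly_euler // => /eqP.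
  rewrite mulf_eq0 gt_eqF ?powR_gt0 //= => /eqP ->.
  by rewrite mulr0 addr0.
- apply/leq_sizeP => j; rewrite leq_eqVlt => /predU1P[<-|kj].
    rewrite coefB coefZ.
    have /monicP := falling_poly_monic k; rewrite /lead_coef size_falling_poly /= => ->.
    by rewrite mulr1 subrr.
  rewrite coefB coefZ.
  have /leq_sizeP/(_ j kj) -> : (size (falling_poly k) <= k.+1)%N.
    by rewrite size_falling_poly.
  by move/leq_sizeP/(_ j kj): sP => ->; rewrite mulr0 subrr.
Qed.

Lemma euler_form_vanish al c k z : 0 < z ->
  (forall P, (size P <= k)%N -> euler_form al c z P = 0) ->
  forall j, (j < k)%N -> gpoly al c j z = 0.
Proof.
by move=> z0 H j jk; rewrite gpoly_euler // H ?mulr0 // size_falling_poly.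
Qed.

Definition vanish (g : nat -> R -> R) (W : seq R) : Prop :=
  forall z j, (j < count_mem z W)%N -> g j z = 0.

(** Coefficients of [t^(al i0 + 1) (t^(- al i0) g)'] for [g] with coefficients
    [c]: dividing by one power and differentiating removes that power. *)
Definition tilt al (i0 : 'I_N) c : 'I_N -> R := fun i => c i * (al i - al i0).

Lemma euler_form_tilt al i0 c t P :
  euler_form al (tilt al i0 c) t P = euler_form al c t (P * ('X - (al i0)%:P)).
Proof. by apply: eq_bigr => i _; rewrite hornerM hornerXsubC /tilt; ring. Qed.

Lemma gpoly_rolle al i0 c s t : 0 < s -> s < t ->
  gpoly al c 0 s = 0 -> gpoly al c 0 t = 0 ->
  exists2 u, s < u < t & gpoly al (tilt al i0 c) 0 u = 0.
Proof.
move=> s0 st gs gt.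
pose al' i := al i - al i0.
have E u : 0 < u -> gpoly al' c 0 u = u `^ (- al i0) * gpoly al c 0 u.
  move=> u0; rewrite !gpolyE mulr_sumr; apply: eq_bigr => i _.
  by rewrite /al' powRD ?(gt_eqF u0) ?implybT //; ring.
have t0 : 0 < t by exact: lt_trans st.
have pos u : s < u -> 0 < u by exact: lt_trans.
have D u : u \in `]s, t[%R -> is_derive u 1 (gpoly al' c 0) (gpoly al' c 1 u).
  by rewrite in_itv /= => /andP[su _]; apply: is_derive_gpoly; apply: pos.
have C : {within `[s, t], continuous (gpoly al' c 0)}.
  apply: continuous_in_subspaceT => u; rewrite inE /= in_itv /= => /andP[su _].
  by apply: gpoly_continuous; apply: lt_le_trans su.
have [u] := @MVT _ _ _ _ _ st D C.
rewrite in_itv /= => /andP[su ut]; rewrite (E _ t0) (E _ s0) gs gt !mulr0 subrr.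
move=> /esym/eqP; rewrite mulf_eq0 subr_eq0 (gt_eqF st) orbF => /eqP H.
exists u; first by rewrite su.
have -> : gpoly al (tilt al i0 c) 0 u = u `^ (al i0 + 1) * gpoly al' c 1 u.
  rewrite gpolyE mulr_sumr; apply: eq_bigr => i _.
  rewrite /falling_poly big_ord_recl big_ord0 mulr1 hornerXsubC subr0 /tilt /al'.
  rewrite (_ : u `^ al i = u `^ (al i0 + 1) * u `^ (al i - al i0 - 1)); first by ring.
  rewrite -powRD ?(gt_eqF (pos _ su)) ?implybT //; congr (_ `^ _); ring.
by rewrite H mulr0.
Qed.

(** Zeros of a sorted list produce one zero fewer for the tilted coefficients:
    equal neighbours keep a copy of themselves (one order is lost), distinct
    neighbours contribute a Rolle point strictly between them. *)
Lemma rolle_multiplicities al i0 c (x : R) (s : seq R) : 0 < x ->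
  path <=%R x s -> (forall z, z \in x :: s -> gpoly al c 0 z = 0) ->
  exists W, [/\ size W = size s, (forall z, z \in W -> x <= z) &
    forall z, if z \in x :: s
      then is_true (count_mem z W <= (count_mem z (x :: s)).-1)%N
      else (count_mem z W <= 1)%N /\
           ((0 < count_mem z W)%N -> gpoly al (tilt al i0 c) 0 z = 0)].
Proof.
elim: s x => [|y s IH] x x0 /=.
  by move=> _ _; exists [::]; split=> // z; case: ifP.
move=> /andP[xy ys] g0.
have [] := IH y (lt_le_trans x0 xy) ys.
  by move=> z zs; apply: g0; rewrite inE zs orbT.
move=> W [sW geW cW].
have lex z : z \in y :: s -> y <= z.
  by rewrite inE => /predU1P[->//|]; move: z; apply/allP/(order_path_min le_trans).
move: xy; rewrite le_eqVlt => /predU1P[xy|xy].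
  subst y; exists (x :: W); split => /=; first by rewrite sW.
    by move=> z; rewrite inE => /predU1P[->//|/geW].
  move=> z; move: (cW z); rewrite !inE.
  case: (eqVneq z x) => [->|zx] /=.
    by rewrite eqxx /=; lia.
  by rewrite [x == z]eq_sym (negbTE zx).
have [u /andP[xu uy] gu] := gpoly_rolle i0 x0 xy (g0 x (mem_head _ _))
  (g0 y (mem_behead (s := [:: x, y & s]) (mem_head _ _))).
have nmem z : z < y -> count_mem z (y :: s) = 0%N /\ count_mem z W = 0%N.
  by move=> zy; split; apply/count_memPn/negP; [move/lex|move/geW]; rewrite leNgt zy.
exists (u :: W); split => /=; first by rewrite sW.
  move=> z; rewrite inE => /predU1P[->|/geW]; first exact: ltW.
  by apply: le_trans; apply: ltW.
move=> z; move: (cW z); rewrite [z \in [:: x, y & s]]inE.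
case: (eqVneq z x) => [-> _|zx] /=.
  by have [_ ->] := nmem x xy; rewrite (gt_eqF xu).
case: (eqVneq u z) => [<-|uz]; last by rewrite !add0n.
have [E1 ->] := nmem u uy.
have /negbTE -> // : u \notin y :: s by apply/count_memPn.
Qed.

Lemma vanish_sub (g : nat -> R -> R) (W W' : seq R) :
  (forall z, (count_mem z W' <= count_mem z W)%N) -> vanish g W -> vanish g W'.
Proof. by move=> sub v z j jz; apply: v; apply: leq_trans (sub z). Qed.

Lemma tilt_vanish al i0 c (W : seq R) : (forall z, z \in W -> 0 < z) ->
  vanish (gpoly al c) W ->
  exists W', [/\ size W' = (size W).-1, (forall z, z \in W' -> 0 < z) &
    vanish (gpoly al (tilt al i0 c)) W'].
Proof.
move=> pos van.
have [s [E srt]] : exists s : seq R, perm_eq s W /\ sorted <=%R s.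
  by exists (sort <=%R W); rewrite perm_sort perm_refl sort_sorted //; apply: le_total.
have E1 z : count_mem z W = count_mem z s by move/permP: E => ->.
have pos' z : z \in s -> 0 < z by rewrite (perm_mem E); apply: pos.
have {}van : vanish (gpoly al c) s by apply: vanish_sub van => z; rewrite E1.
rewrite -(perm_size E).
case: s srt {E E1 pos} pos' van => [|x s] /= srt pos van; first by exists [::].
have x0 : 0 < x by apply: pos; apply: mem_head.
have [|W' [sW geW cW]] := @rolle_multiplicities al i0 c x s x0 srt.
  by move=> z; rewrite -has_pred1 has_count => /van.
exists W'; split => //.
  by move=> z /geW; apply: lt_le_trans.
move=> z j jz.
have z0 : 0 < z.
  apply: lt_le_trans (geW z _) => //.
  by rewrite -has_pred1 has_count; apply: leq_ltn_trans jz.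
move: (cW z); case: ifP => [zs H|_ [H1 H2]]; last first.
  have -> : j = 0%N by lia.
  by apply: H2; lia.
apply: (euler_form_vanish z0 _ jz) => P sP; rewrite euler_form_tilt.
apply: (@vanish_euler_form al c (count_mem z (x :: s)) z z0); first by move=> ? /van.
move: zs; rewrite -has_pred1 has_count => zs.
apply: leq_trans (size_polyMleq _ _) _; rewrite size_XsubC; lia.
Qed.

(** Descartes-type bound by induction on the number of nonzero coefficients:
    tilting at a nonzero coefficient removes it and at most one zero. *)
Lemma zero_count_supp al c (W : seq R) : injective al ->
  (forall z, z \in W -> 0 < z) -> vanish (gpoly al c) W ->
  (#|[pred i | c i != 0%R]| <= size W)%N -> forall i, c i = 0.
Proof.
move=> inj; move: {2}#|_| (leqnn #|[pred i | c i != 0]|) => k.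
elim: k c W => [|k IH] c W ck pos van cW.
  move=> i; apply/eqP/negPn/negP => ci.
  by move: ck; rewrite leqn0 => /eqP/card0_eq/(_ i); rewrite !inE ci.
case: (pickP [pred i | c i != 0]) => [i0 /= ci0|H]; last first.
  by move=> i; move: (H i) => /= /negbFE/eqP.
have [W' [sW' pos' van']] := tilt_vanish i0 pos van.
have cardE : #|[pred i | c i != 0]| = #|[pred i | tilt al i0 c i != 0]|.+1.
  rewrite (cardD1 i0) inE /= ci0; congr _.+1; apply: eq_card => i.
  rewrite !inE /= /tilt mulf_eq0 negb_or subr_eq0 andbC; congr andb.
  by rewrite (inj_eq inj).
have Z : forall i, tilt al i0 c i = 0.
  apply: IH pos' van' _; [by rewrite -ltnS -cardE|].
  by rewrite sW'; move: cW; rewrite cardE; case: size.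
have Z' i : i != i0 -> c i = 0.
  move=> ii0; apply/eqP; move/eqP: (Z i); rewrite /tilt mulf_eq0 subr_eq0.
  by rewrite (inj_eq inj) (negbTE ii0) orbF.
case: W cW pos van {sW'} => [|z W]; first by rewrite cardE.
move=> _ /(_ z (mem_head _ _)) z0 /(_ z 0%N).
rewrite /= eqxx gpolyE (bigD1 i0) //= big1 => [|i /Z' ->]; last by rewrite mul0r.
move=> /(_ isT)/eqP; rewrite addr0 mulf_eq0 (negbTE ci0) /= powR_eq0.
by rewrite (gt_eqF z0).
Qed.

(** The powers form an extended Chebyshev system on the positive half-line: as
    many zeros as functions, counted with multiplicities, force [c = 0]. *)
Lemma zero_count al c (W : seq R) : injective al ->
  (forall z, z \in W -> 0 < z) -> vanish (gpoly al c) W ->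
  (N <= size W)%N -> forall i, c i = 0.
Proof.
move=> inj pos van NW; apply: (zero_count_supp inj pos van).
by apply: leq_trans (max_card _) _; rewrite card_ord.
Qed.

End GeneralizedPolynomials.

(** * Signs near zeros of known order *)

Definition has_order (R : realType) (g : nat -> R -> R) (k : nat) (z : R) : Prop :=
  (forall j, (j < k)%N -> g j z = 0) /\ g k z != 0.

Section LocalSign.
Context {R : realType}.
Implicit Types (z t u : R) (W : seq R).

(** Taylor's formula up to sign, by induction on [k]: the mean value theorem
    writes [G 0 t] as [(t - z) * G 1 v] with [v] between [z] and [t], and
    [t - z], [v - z] have the same sign. *)
Lemma derivative_sign_near (G : nat -> R -> R) z k : 0 < z ->
  (forall j t, 0 < t -> is_derive t 1 (G j) (G j.+1 t)) ->
  (forall j, (j < k)%N -> G j z = 0) -> 0 < G k z ->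
  exists2 e : R, 0 < e & forall t, t != z -> `|z - t| < e ->
    0 < t /\ 0 < G 0%N t * (t - z) ^+ k.
Proof.
move=> z0; elim: k G => [|k IH] G D G0 Gk.
  have C : {for z, continuous (G 0%N)}.
    apply: differentiable_continuous; apply/derivable1_diffP.
    exact: (@ex_derive _ _ _ _ _ _ _ (D 0%N z z0)).
  have : \forall t \near z, 0 < t /\ 0 < G 0%N t.
    near=> t; split; near: t; first exact: lt_nbhsr.
    exact: (cvgr_gt _ C).
  case/nbhs_ballP => e /= e0 H; exists e => // t _ te.
  by rewrite expr0 mulr1; apply: H.
have [e e0 H] := IH (fun j => G j.+1) (fun j t => D j.+1 t) (fun j jk => G0 j.+1 jk) Gk.
have M t u : 0 < t -> t < u ->
    exists2 v, t < v < u & G 0%N u - G 0%N t = G 1%N v * (u - t).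
  move=> t0 tu.
  have [||v] := @MVT _ (G 0%N) (G 1%N) _ _ tu; last by rewrite in_itv /=; exists v.
    by move=> v; rewrite in_itv /= => /andP[tv _]; apply: D; apply: lt_trans tv.
  apply: continuous_in_subspaceT => v; rewrite inE /= in_itv /= => /andP[tv _].
  apply: differentiable_continuous; apply/derivable1_diffP.
  exact: (@ex_derive _ _ _ _ _ _ _ (D 0%N v (lt_le_trans t0 tv))).
exists e => // t tz te; have [t0 _] := H t tz te; split => //.
have Gz : G 0%N z = 0 by apply: G0.
have [v [E vz ve]] : exists v, [/\ G 0%N t = G 1%N v * (t - z), 0 < (t - z) / (v - z) &
    v != z /\ `|z - v| < e].
  case: (ltgtP t z) tz => // [tz|zt] _.
    have [v /andP[tv vz] E] := M t z t0 tz; exists v; split.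
    - by move: E; rewrite Gz => E; lra.
    - by rewrite -mulrNN -invrN; apply: mulr_gt0; rewrite ?invr_gt0; lra.
    - split; first by rewrite lt_eqF.
      by apply: lt_trans te; rewrite !gtr0_norm ; lra.
  have [v /andP[zv vt] E] := M z t z0 zt; exists v; split.
  - by rewrite -E Gz subr0.
  - by apply: mulr_gt0; rewrite ?invr_gt0; lra.
  - split; first by rewrite gt_eqF.
    by apply: lt_trans te; rewrite !ltr0_norm ; lra.
case: ve => vz' ve.
have [_ P] := H v vz' ve.
have vz0 : v - z != 0 by rewrite subr_eq0.
have -> : G 0%N t * (t - z) ^+ k.+1 =
    (G 1%N v * (v - z) ^+ k) * (((t - z) / (v - z)) ^+ k * (t - z) ^+ 2).
  rewrite E expr_div_n exprS; field; exact: expf_neq0.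
rewrite mulr_gt0 // mulr_gt0 //; first exact: exprn_gt0.
by rewrite lt0r sqr_ge0 andbT sqrf_eq0 subr_eq0.
Unshelve. all: by end_near.
Qed.

Lemma isolated_entry W z :
  exists2 e : R, 0 < e & forall w, w \in W -> w != z -> e <= `|z - w|.
Proof.
elim: W => [|w W [e e0 H]]; first by exists 1.
case: (eqVneq w z) => [->|wz].
  by exists e => // v; rewrite inE => /predU1P[->|/H//]; rewrite eqxx.
exists (Num.min e `|z - w|).
  by rewrite lt_min e0 normr_gt0 subr_eq0 eq_sym.
move=> v; rewrite inE => /predU1P[->|/H{}H] vz; rewrite ge_min ?lexx ?orbT //.
by rewrite H.
Qed.

Definition nabove z W : nat := count (fun w => z < w) W.

(** Moving off [z] to the right keeps the number of larger entries; moving to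
    the left adds the copies of [z].  This matches the sign [(t - z) ^+ k] of a
    zero of order [k]. *)
Lemma count_gt_near W z : exists2 e : R, 0 < e & forall t, t != z -> `|z - t| < e ->
  count_mem t W = 0%N /\
  nabove t W = (nabove z W + (if (t < z)%R then count_mem z W else 0))%N.
Proof.
have [e e0 H] := isolated_entry W z; exists e => // t tz te.
have tW : t \notin W by apply/negP => /H /(_ tz); rewrite leNgt te.
split; first exact/count_memPn.
rewrite /nabove.
case: (ltP t z) => [tz'|zt].
  rewrite -count_predUI; rewrite [X in (_ + X)%N](_ : _ = 0%N) ?addn0; last first.
    apply/eqP; rewrite eqn0Ngt -has_count -all_predC; apply/allP => w _ /=.
    by case: eqVneq => [->|]; rewrite ?ltxx ?andbF.
  apply: eq_in_count => w wW /=.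
  case: (ltgtP w z) => [wz|zw|->]; rewrite ?orbF ?orbT //=; last exact: lt_trans zw.
  apply/negbTE; rewrite -leNgt.
  have := H w wW (negbT (lt_eqF wz)); move: te; rewrite !gtr0_norm ?subr_gt0 //; lra.
rewrite addn0; apply: eq_in_count => w wW /=.
case: (ltgtP w z) => [wz|zw|->].
- by apply/negbTE; rewrite -leNgt; apply: le_trans zt; apply: ltW.
- have {}zt : z < t by rewrite lt_neqAle eq_sym tz.
  have := H w wW (negbT (gt_eqF zw)); move: te; rewrite !ltr0_norm ?subr_lt0 //; lra.
- by apply/negbTE; rewrite -leNgt.
Qed.

End LocalSign.

Lemma clamp_contraction (R : realType) (u v z t : R) : u <= v ->
  `|Num.max u (Num.min v z) - Num.max u (Num.min v t)| <= `|z - t|.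
Proof.
wlog zt : z t / z <= t.
  move=> H uv; case: (leP z t) => [zt|/ltW tz]; first exact: H.
  by rewrite distrC [X in _ <= X]distrC; exact: H.
move=> uv; rewrite distrC [X in _ <= X]distrC [X in _ <= X]ger0_norm ?subr_ge0 //.
rewrite ger0_norm; rewrite ?subr_ge0 /Num.max /Num.min.
all: by case: (ltP v z) => ?; case: (ltP v t) => ?; do !case: ltP => ?; lra.
Qed.

Section Sign.
Context {R : realType} {N : nat} (al : 'I_N -> R).
Implicit Types (c : 'I_N -> R) (z t u v : R) (W : seq R).

Lemma gpoly_sign_near c z k : 0 < z -> has_order (gpoly al c) k z ->
  exists2 e : R, 0 < e & forall t, t != z -> `|z - t| < e ->
    0 < t /\ 0 < gpoly al c 0 t * (gpoly al c k z * (t - z) ^+ k).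
Proof.
move=> z0 [c0 ck].
(* scaling by the leading derivative makes that derivative positive *)
have [||e e0 H] := @derivative_sign_near R
  (gpoly al (fun i => gpoly al c k z * c i)) z k z0
  (fun j t pt => is_derive_gpoly _ _ j pt).
- by move=> j jk; rewrite gpolyZ (c0 _ jk) mulr0.
- by rewrite gpolyZ lt0r -expr2 sqr_ge0 expf_neq0.
exists e => // t tz te; have [t0] := H t tz te.
by rewrite gpolyZ => P; split; rewrite // mulrCA mulrA.
Qed.

Definition zeros_exact_on c u v W : Prop :=
  forall z, u <= z <= v -> has_order (gpoly al c) (count_mem z W) z.

(** The sign that a function with zero list [W] would have far to the right,
    predicted from its first nonzero derivative at [z]. *)
Definition nsign c W z : R :=
  Num.sg (gpoly al c (count_mem z W) z) * (-1) ^+ nabove z W.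

Lemma nsign_near c u v W z : 0 < u -> zeros_exact_on c u v W -> u <= z <= v ->
  exists2 e : R, 0 < e & forall t, u <= t <= v -> `|z - t| < e ->
    nsign c W t = nsign c W z.
Proof.
move=> u0 ex zuv.
have z0 : 0 < z by apply: lt_le_trans u0 _; case/andP: zuv.
have [e1 e10 H1] := gpoly_sign_near z0 (ex z zuv).
have [e2 e20 H2] := count_gt_near W z.
exists (Num.min e1 e2); first by rewrite lt_min e10.
move=> t tuv; case: (eqVneq t z) => [->//|tz]; rewrite lt_min => /andP[te1 te2].
have [t0 /gtr0_sg] := H1 t tz te1.
rewrite !sgrM sgrX /nsign.
have [-> ->] := H2 t tz te2.
have /negP sz0 : gpoly al c (count_mem z W) z != 0 by case: (ex z zuv).
have sz : Num.sg (gpoly al c (count_mem z W) z) *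
    Num.sg (gpoly al c (count_mem z W) z) = 1.
  by rewrite -expr2 sqr_sg; move/negP: sz0 => ->.
set A := Num.sg (gpoly al c 0 t); set B := Num.sg _ in sz *.
case: (ltP t z) => [tz'|zt].
  rewrite [Num.sg (t - z)]ltr0_sg ?subr_lt0 // => E.
  have {E} -> : A = B * (-1) ^+ count_mem z W.
    have sq : (B * (-1) ^+ count_mem z W) * (B * (-1) ^+ count_mem z W) = 1.
      by rewrite mulrACA sz -expr2 sqrr_sign mulr1.
    by rewrite -[LHS]mulr1 -[X in A * X]sq mulrA E mul1r.
  by rewrite -mulrA exprD [X in B * X]mulrCA -expr2 sqrr_sign mulr1.
rewrite [Num.sg (t - z)]gtr0_sg ?subr_gt0 ?lt_neqAle 1?eq_sym ?tz //.
rewrite expr1n mulr1 addn0 => E; congr (_ * _).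
by rewrite -[LHS]mulr1 -sz mulrA E mul1r.
Qed.

Lemma nsign_neq0 c u v W z : zeros_exact_on c u v W -> u <= z <= v -> nsign c W z != 0.
Proof.
move=> ex /ex[_ H]; rewrite /nsign mulf_neq0 ?sgr_eq0 //.
by rewrite expf_neq0 // oppr_eq0 oner_neq0.
Qed.

(** Locally constant by [nsign_near], hence constant on the interval; the
    intermediate value theorem is applied after extending constantly outside. *)
Lemma nsign_const c u v W : 0 < u -> u <= v -> zeros_exact_on c u v W ->
  nsign c W u = nsign c W v.
Proof.
move=> u0 uv ex.
pose cl t := Num.max u (Num.min v t).
have clP t : u <= cl t <= v.
  by rewrite /cl le_max lexx /= ge_max uv ge_min lexx.
have clL z t : `|cl z - cl t| <= `|z - t| by apply: clamp_contraction.
pose T t := nsign c W (cl t).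
have C : continuous T.
  move=> z; apply: cvg_near_cst.
  have [e e0 H] := nsign_near u0 ex (clP z).
  apply/nbhs_ballP; exists e => //= t zt.
  by apply/H; [exact: clP|apply: le_lt_trans (clL _ _) zt].
have Tn t : T t != 0 by apply: nsign_neq0 ex (clP t).
have Tsq t : T t ^+ 2 = 1.
  move: (Tn t); rewrite /T /nsign exprMn sqrr_sign mulr1 sqr_sg.
  by rewrite mulf_eq0 negb_or sgr_eq0 => /andP[-> _].
have Tu : T u = nsign c W u by rewrite /T /cl min_r ?maxxx.
have Tv : T v = nsign c W v by rewrite /T /cl minxx max_r.
rewrite -Tu -Tv.
have [//|TT] := eqVneq (T u) (T v).
have [||w _ Tw] := @IVT R T u v 0 uv.
- exact: continuous_subspaceT.
- move: (Tsq u) (Tsq v) => /eqP + /eqP.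
  rewrite !sqrf_eq1 => /orP[] /eqP Eu /orP[] /eqP Ev; move: TT;
    rewrite Eu Ev ?eqxx // => _.
  + by rewrite min_r ?max_l; lra.
  + by rewrite min_l ?max_r; lra.
- by move: (Tn w); rewrite Tw eqxx.
Qed.

End Sign.

(** * Interpolation determinants *)

Section Determinant.
Context {R : realType} {n : nat} (al : 'I_n.+1 -> R).
Hypothesis alI : injective al.
Implicit Types (c : 'I_n.+1 -> R) (z t u v : R) (W : seq R) (x : n.-tuple R).

Let F := fun (i : 'I_n.+1) (t : R) => t `^ al i.

Lemma derive1n_powR m j z : 0 < z ->
  derive1n m (F j) z = (falling_poly m).[al j] * z `^ (al j - m%:R).
Proof.
move=> z0; have -> : F j = gpoly al (fun i => (i == j)%:R) 0.
  apply/funext => t; rewrite gpolyE (bigD1 j) //= eqxx mul1r big1 ?addr0 //.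
  by move=> i /negbTE ->; rewrite mul0r.
rewrite derive1n_gpoly // /gpoly (bigD1 j) //= eqxx mul1r big1 ?addr0 //.
by move=> i /negbTE ->; rewrite mul0r.
Qed.

Lemma count_take_lt x (k : 'I_n) :
  (count_mem (tnth x k) (take k x) < count_mem (tnth x k) x)%N.
Proof.
rewrite -{2}(cat_take_drop k x) count_cat -[X in (X < _)%N]addn0 ltn_add2l.
rewrite -has_count has_pred1 (drop_nth (tnth x k)) ?size_tuple //.
by rewrite -tnth_nth mem_head.
Qed.

(** The [j]-th copy of [z] in [s] sits at a position preceded by exactly [j]
    copies, so that every derivative below the multiplicity occurs as a row. *)
Lemma count_take_ex (s : seq R) z j : (j < count_mem z s)%N ->
  exists2 k, (k < size s)%N & nth 0 s k = z /\ count_mem z (take k s) = j.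
Proof.
elim: s j => [//|y s IH] j /=; case: eqVneq => [-> | yz] /=.
  case: j => [|j] jc; first by exists 0%N.
  by have [k ks [kz kj]] := IH j jc; exists k.+1 => //=; rewrite eqxx kj.
by rewrite add0n => /IH[k ks [kz kj]]; exists k.+1 => //=; rewrite (negbTE yz).
Qed.

Lemma osc_mul_lower c t x : (forall z, z \in x -> 0 < z) ->
  (forall k : 'I_n, \sum_j osc_mx F t x (rshift 1 k) j * c j = 0) <->
  vanish (gpoly al c) x.
Proof.
move=> x0.
have E k : \sum_j osc_mx F t x (rshift 1 k) j * c j =
    gpoly al c (count_mem (tnth x k) (take k x)) (tnth x k).
  apply: eq_bigr => j _; rewrite col_mxEd mxE derive1n_powR ?x0 ?mem_tnth //.
  by rewrite mulrC.
split=> [H z j jz|H k]; last by rewrite E H // count_take_lt.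
have [k ks [kz kj]] := count_take_ex jz.
have kn : (k < n)%N by rewrite -(size_tuple x).
have := H (Ordinal kn); rewrite E (tnth_nth 0) /= kz.
by rewrite kj.
Qed.

Lemma osc_mul_first c t x :
  \sum_j osc_mx F t x (lshift n ord0) j * c j = gpoly al c 0 t.
Proof.
rewrite gpolyE; apply: eq_bigr => j _; by rewrite col_mxEu mxE mulrC.
Qed.

Lemma vanish_cons c W t : t \notin W -> vanish (gpoly al c) W -> gpoly al c 0 t = 0 ->
  vanish (gpoly al c) (t :: W).
Proof.
move=> tW van g0 z j /=; case: eqVneq => [<-|_]; last exact: van.
by rewrite (count_memPn tW); case: j.
Qed.

(** A kernel vector would be the coefficients of a nonzero function vanishing at
    [x] and at [t], that is, at [n + 1] points. *)
Lemma osc_det_neq0 t x : (forall z, z \in x -> 0 < z) -> 0 < t -> t \notin x ->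
  \det (osc_mx F t x) != 0.
Proof.
move=> x0 t0 tx; apply/negP; rewrite -det_tr => /det0P[v v0 vM].
pose c j := v ord0 j.
have H i : \sum_j osc_mx F t x i j * c j = 0.
  move/matrixP: vM => /(_ ord0 i); rewrite mxE [RHS]mxE => E; rewrite -[RHS]E.
  by apply: eq_bigr => j _; rewrite [_^T _ _]mxE mulrC.
have c0 : forall i, c i = 0.
  apply: (@zero_count _ _ al c (t :: x) alI); last by rewrite /= size_tuple.
    by move=> z; rewrite inE => /predU1P[->//|/x0].
  apply: vanish_cons => //; last by rewrite -(osc_mul_first c t x) H.
  by apply/(osc_mul_lower c t x0) => k.
by case/negP: v0; apply/eqP/rowP => j; rewrite mxE; apply: c0.
Qed.

(** The cofactors along the first row, which do not involve the value [t]
    entering that row; [0] is a dummy value. *)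
Definition osc_cof x : 'I_n.+1 -> R := fun j => cofactor (osc_mx F 0 x) ord0 j.

Lemma osc_cofE t x j : cofactor (osc_mx F t x) ord0 j = osc_cof x j.
Proof.
rewrite /osc_cof /cofactor; congr (_ * \det _); apply/matrixP => k l.
rewrite [LHS]mxE [LHS]mxE [RHS]mxE [RHS]mxE.
have -> : lift ord0 k = rshift 1 (k : 'I_n) :> 'I_(1 + n) by apply: val_inj.
by rewrite /osc_mx [LHS]col_mxEd [RHS]col_mxEd [LHS]mxE [RHS]mxE.
Qed.

Lemma osc_det t x : \det (osc_mx F t x) = gpoly al (osc_cof x) 0 t.
Proof.
rewrite -(osc_mul_first _ t x) (expand_det_row _ (lshift n ord0)).
apply: eq_bigr => j _; rewrite -(osc_cofE t).
by congr (_ * cofactor _ _ _); apply: val_inj.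
Qed.

(** Expanding along the first row a matrix with that row replaced by a later
    one gives a determinant with two equal rows. *)
Lemma osc_cof_vanish x : (forall z, z \in x -> 0 < z) ->
  vanish (gpoly al (osc_cof x)) x.
Proof.
move=> x0; apply/(osc_mul_lower _ 0 x0) => k.
have /matrixP/(_ (rshift 1 k) ord0) := mul_mx_adj (osc_mx F 0 x).
rewrite mxE [RHS]mxE => E.
rewrite -[RHS](_ : \det (osc_mx F 0 x) *+ (rshift 1 k == ord0 :> 'I_(1 + n)) = 0) //.
by rewrite -E; apply: eq_bigr => j _; rewrite [\adj _ _ _]mxE.
Qed.

Lemma fresh_pos W : exists2 t, 0 < t & t \notin W.
Proof.
exists (1 + \sum_(w <- W) `|w|); first by rewrite ltr_wpDr // sumr_ge0.
apply/negP => tW.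
have : 1 + \sum_(w <- W) `|w| <= \sum_(w <- W) `|w|.
  rewrite [X in _ <= X](big_rem _ tW) /=.
  by rewrite ger0_norm ?addr_ge0 ?sumr_ge0 // ler_wpDr ?sumr_ge0.
lra.
Qed.

Lemma vanish_lin c c' (r : R) W : vanish (gpoly al c) W -> vanish (gpoly al c') W ->
  vanish (gpoly al (fun i => c i + r * c' i)) W.
Proof. by move=> v v' z j jz; rewrite gpoly_lin v // v' // mulr0 addr0. Qed.

(** The zeros [x] determine a function up to a factor: choose the factor to
    agree at a further point, and the difference has [n + 1] zeros. *)
Lemma vanish_osc_det c x : (forall z, z \in x -> 0 < z) -> vanish (gpoly al c) x ->
  exists C, forall t, gpoly al c 0 t = C * \det (osc_mx F t x).
Proof.
move=> x0 van; have [t0 t00 t0x] := fresh_pos x.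
have D0 := osc_det_neq0 x0 t00 t0x.
pose C := gpoly al c 0 t0 / \det (osc_mx F t0 x); exists C => t.
have H : forall i, c i + - C * osc_cof x i = 0.
  apply: (@zero_count _ _ al _ (t0 :: x) alI); last by rewrite /= size_tuple.
    by move=> z; rewrite inE => /predU1P[->//|/x0].
  apply: vanish_cons => //; first exact: vanish_lin (osc_cof_vanish x0).
  by rewrite gpoly_lin -osc_det /C mulNr divfK // subrr.
rewrite osc_det -gpolyZ; apply: eq_bigr => i _; congr (_ * _).
by have := H i; lra.
Qed.

(** With [n] zeros already present, a further order at any point would exceed
    the maximal number of zeros. *)
Lemma full_zeros_exact c W z : (exists i, c i != 0) -> (forall w, w \in W -> 0 < w) ->
  vanish (gpoly al c) W -> size W = n -> 0 < z ->
  has_order (gpoly al c) (count_mem z W) z.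
Proof.
move=> [i ci] W0 van sW z0; split; first by move=> j; apply: van.
apply/negP => /eqP g0; case/negP: ci; apply/eqP.
apply: (@zero_count _ _ al c (z :: W) alI); last by rewrite /= sW.
  by move=> w; rewrite inE => /predU1P[->//|/W0].
move=> w j /=; case: eqVneq => [<-|_]; last exact: van.
by rewrite add1n ltnS leq_eqVlt => /predU1P[->//|/van].
Qed.

Lemma prescribed_zeros W : (forall w, w \in W -> 0 < w) -> size W = n ->
  exists c, forall z, 0 < z -> has_order (gpoly al c) (count_mem z W) z.
Proof.
move=> W0 /eqP sW; pose x := Tuple sW; exists (osc_cof x) => z z0.
apply: full_zeros_exact => //; last 2 first.
- exact: (@osc_cof_vanish x).
- exact/eqP.
have [t t0 tx] := fresh_pos x.
have := osc_det_neq0 (x := x) W0 t0 tx; rewrite osc_det gpolyE.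
move=> H; apply/existsP; apply: contraNT H => /existsPn H.
by rewrite big1 // => i _; move: (H i) => /negPn/eqP ->; rewrite mul0r.
Qed.

End Determinant.

(** * Nonnegative generalized polynomials and extremal minorants *)

Section Nonneg.
Context {R : realType} {n : nat} (al : 'I_n.+1 -> R) (a b : R).
Hypotheses (alI : injective al) (a_gt0 : 0 < a) (ltab : a < b).
Implicit Types (c f p q u : 'I_n.+1 -> R) (z t : R) (W Z w : seq R).

Definition nonneg f : Prop := forall t, a <= t <= b -> 0 <= gpoly al f 0 t.
Definition between f u : Prop :=
  forall t, a <= t <= b -> 0 <= gpoly al u 0 t <= gpoly al f 0 t.

Lemma pos_seg z : a <= z <= b -> 0 < z.
Proof. by case/andP=> az _; apply: lt_le_trans az. Qed.

Lemma between_nonneg f u : between f u ->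
  nonneg u /\ nonneg (fun i => f i - u i).
Proof.
move=> H; split=> t /H/andP[H1 H2] //.
by rewrite gpolyB subr_ge0.
Qed.

Lemma near_right z e : a <= z < b -> 0 < e ->
  exists t, [/\ a <= t <= b, z < t & `|z - t| < e].
Proof.
move=> /andP[az zb] e0; exists (z + Num.min e (b - z) / 2).
have m0 : 0 < Num.min e (b - z) by rewrite lt_min e0 subr_gt0.
have m1 : Num.min e (b - z) <= e by rewrite ge_min lexx.
have m2 : Num.min e (b - z) <= b - z by rewrite ge_min lexx orbT.
by split; [lra|lra|rewrite opprD addNKr normrN gtr0_norm; lra].
Qed.

Lemma near_left z e : a < z <= b -> 0 < e ->
  exists t, [/\ a <= t <= b, t < z & `|z - t| < e].
Proof.
move=> /andP[az zb] e0; exists (z - Num.min e (z - a) / 2).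
have m0 : 0 < Num.min e (z - a) by rewrite lt_min e0 subr_gt0.
have m1 : Num.min e (z - a) <= e by rewrite ge_min lexx.
have m2 : Num.min e (z - a) <= z - a by rewrite ge_min lexx orbT.
by split; [lra|lra|rewrite opprB addrC subrK gtr0_norm; lra].
Qed.

Lemma near_seg z e : a <= z <= b -> 0 < e ->
  exists t, [/\ a <= t <= b, t != z & `|z - t| < e].
Proof.
move=> /andP[az zb] e0; case: (ltP z b) => [zb'|bz].
  have [|t [H1 H2 H3]] := @near_right z e _ e0; first by rewrite az.
  by exists t; split => //; rewrite gt_eqF.
have [|t [H1 H2 H3]] := @near_left z e _ e0; first by rewrite zb (lt_le_trans ltab).
by exists t; split => //; rewrite lt_eqF.
Qed.

Lemma sign_transfer (f1 f2 g1 g2 x : R) : 0 < f1 * (f2 * x) -> 0 < g1 * (g2 * x) ->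
  0 < f2 * g2 -> 0 < f1 * g1.
Proof.
move=> H1 H2 H3; have := mulr_gt0 H1 H2.
have -> : f1 * (f2 * x) * (g1 * (g2 * x)) = (f1 * g1) * ((f2 * g2) * x ^+ 2) by ring.
rewrite pmulr_lgt0 // mulr_gt0 // lt0r sqr_ge0 andbT sqrf_eq0.
by apply: contraTneq H1 => ->; rewrite !mulr0 ltxx.
Qed.

(** Near [z] the functions behave as [k]-th powers with these coefficients, so
    opposite signs of the coefficients would give opposite signs of [f], [g]. *)
Lemma nonneg_compare f g k z : nonneg f -> nonneg g -> a <= z <= b ->
  has_order (gpoly al f) k z -> (forall j, (j < k)%N -> gpoly al g j z = 0) ->
  0 <= gpoly al f k z * gpoly al g k z.
Proof.
move=> nf ng zab of_ vg; rewrite leNgt; apply/negP => fg.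
have og : has_order (gpoly al g) k z.
  by split => //; apply: contraTneq fg => ->; rewrite mulr0 ltxx.
have [e1 e10 H1] := gpoly_sign_near (pos_seg zab) of_.
have [e2 e20 H2] := gpoly_sign_near (pos_seg zab) og.
have [|t [tab tz]] := @near_seg z (Num.min e1 e2) zab; first by rewrite lt_min e10.
rewrite lt_min => /andP[/(H1 _ tz)[_ {}H1] /(H2 _ tz)[_ {}H2]].
have H3 : 0 < - gpoly al g 0 t * ((- gpoly al g k z) * (t - z) ^+ k).
  by rewrite mulNr mulNr mulrN opprK.
have := sign_transfer H1 H3; rewrite mulrN oppr_gt0 fg => /(_ isT).
by rewrite mulrN oppr_gt0 ltNge mulr_ge0 ?nf ?ng.
Qed.

(** At the first [j] with nonzero derivative of [u], the functions [u] and
    [f - u] would have opposite derivatives, against [nonneg_compare]. *)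
Lemma between_vanish f u k z : between f u -> a <= z <= b ->
  (forall j, (j < k)%N -> gpoly al f j z = 0) ->
  forall j, (j < k)%N -> gpoly al u j z = 0.
Proof.
move=> fu zab vf; elim/ltn_ind => j IH jk.
have [nu nfu] := between_nonneg fu.
apply/eqP/negP => /negP uj.
have := @nonneg_compare u (fun i => f i - u i) j z nu nfu zab.
rewrite gpolyB vf // sub0r mulrN oppr_ge0 -expr2 leNgt lt0r sqr_ge0 sqrf_eq0 uj /=.
move=> H; suff: false by []. apply: H.
  by split => // l lj; apply: IH => //; apply: ltn_trans jk.
by move=> l lj; rewrite gpolyB vf ?(ltn_trans lj jk) // IH ?subrr // (ltn_trans lj jk).
Qed.

Lemma nonneg_right f k z : nonneg f -> a <= z < b -> has_order (gpoly al f) k z ->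
  0 < gpoly al f k z.
Proof.
move=> nf zab of_.
have zab' : a <= z <= b by case/andP: zab => -> /ltW.
have [e e0 H] := gpoly_sign_near (pos_seg zab') of_.
have [t [tab zt te]] := near_right zab e0.
have [_] := H t (negbT (gt_eqF zt)) te.
have := nf t tab; rewrite le_eqVlt => /predU1P[<-|ft]; first by rewrite mul0r ltxx.
rewrite pmulr_rgt0 // pmulr_lgt0 //.
by apply/exprn_gt0; rewrite subr_gt0.
Qed.

Lemma nonneg_left f k z : nonneg f -> a < z <= b -> has_order (gpoly al f) k z ->
  0 < gpoly al f k z * (-1) ^+ k.
Proof.
move=> nf zab of_.
have zab' : a <= z <= b by case/andP: zab => /ltW ->.
have [e e0 H] := gpoly_sign_near (pos_seg zab') of_.
have [t [tab zt te]] := near_left zab e0.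
have [_] := H t (negbT (lt_eqF zt)) te.
have := nf t tab; rewrite le_eqVlt => /predU1P[<-|ft]; first by rewrite mul0r ltxx.
have -> : (t - z) ^+ k = (-1) ^+ k * (z - t) ^+ k by rewrite -exprMn mulN1r opprB.
rewrite pmulr_rgt0 // mulrA pmulr_lgt0 //.
by apply/exprn_gt0; rewrite subr_gt0.
Qed.

Lemma nonneg_even f k z : nonneg f -> a < z < b ->
  has_order (gpoly al f) k z -> ~~ odd k.
Proof.
move=> nf /andP[az zb] of_; apply/negP => ok.
have H1 : 0 < gpoly al f k z by apply: nonneg_right nf _ of_; rewrite (ltW az).
have : 0 < gpoly al f k z * (-1) ^+ k by apply: nonneg_left nf _ of_; rewrite az ltW.
by rewrite -signr_odd ok expr1 mulrN1 oppr_gt0 ltNge ltW.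
Qed.

(** At [b] the function is approached from the left only, so a zero of odd order
    there changes the sign predicted beyond [b]. *)
Lemma nonneg_nsign f Z z : nonneg f -> zeros_exact_on al f a b Z ->
  (forall v, v \in Z -> v <= b) -> a <= z <= b ->
  nsign al f Z z = (-1) ^+ count_mem b Z.
Proof.
move=> nf ex Zb zab.
rewrite (@nsign_const _ _ al f z b Z).
- rewrite /nsign; have -> : nabove b Z = 0%N.
    apply/eqP; rewrite /nabove eqn0Ngt -has_count -all_predC; apply/allP => v /Zb vb /=.
    by rewrite -leNgt.
  rewrite expr0 mulr1.
  have bab : a <= b <= b by rewrite lexx ltW.
  have := @nonneg_left f _ b nf _ (ex b bab); rewrite ltab lexx => /(_ isT).
  move/gtr0_sg; rewrite sgrM sgrX sgrN1 => E.
  rewrite -[LHS]mulr1 -[X in _ * X](@sqrr_sign R (count_mem b Z)) expr2 mulrA E.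
  by rewrite mul1r.
- exact: pos_seg zab.
- by case/andP: zab.
- move=> t /andP[zt tb]; apply: ex; rewrite tb andbT.
  by case/andP: zab => az _; apply: le_trans zt.
Qed.

Lemma same_sign_near f h k z : nonneg f -> a <= z <= b -> has_order (gpoly al f) k z ->
  (forall j, (j < k)%N -> gpoly al h j z = 0) -> 0 < gpoly al f k z * gpoly al h k z ->
  exists2 e : R, 0 < e & forall t, a <= t <= b -> `|z - t| < e -> 0 <= gpoly al h 0 t.
Proof.
move=> nf zab of_ vh fh.
have oh : has_order (gpoly al h) k z.
  by split => //; apply: contraTneq fh => ->; rewrite mulr0 ltxx.
have [e1 e10 H1] := gpoly_sign_near (pos_seg zab) of_.
have [e2 e20 H2] := gpoly_sign_near (pos_seg zab) oh.
exists (Num.min e1 e2); first by rewrite lt_min e10.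
move=> t tab; rewrite lt_min => /andP[te1 te2].
have nft := nf t tab.
have [tz|tz] := eqVneq t z.
  subst t; case: k of_ vh fh {H1 H2 oh} => [|k] of_ vh fh; last by rewrite vh.
  move: nft; rewrite le_eqVlt => /predU1P[fz|fz].
    by move: fh; rewrite -fz mul0r ltxx.
  by apply: ltW; move: fh; rewrite pmulr_rgt0.
have [_ {}H1] := H1 t tz te1; have [_ {}H2] := H2 t tz te2.
have P := sign_transfer H1 H2 fh.
move: nft; rewrite le_eqVlt => /predU1P[fz|fz].
  by move: P; rewrite -fz mul0r ltxx.
by apply: ltW; move: P; rewrite pmulr_rgt0.
Qed.

(** If [p] vanishes at [z] to higher order than [f], then [q >= 0] near [z];
    otherwise the [k]-th derivative of [p] has the sign of that of [f], and a
    small multiple of [q] does not change it.  Convexity in [x] extends the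
    inequality from one value [d] to all smaller ones. *)
Lemma perturb_nonneg_near f p q k z : nonneg f -> nonneg p -> a <= z <= b ->
  has_order (gpoly al f) k z ->
  (forall j, (j < k)%N -> gpoly al p j z = 0) ->
  (forall j, (j < k)%N -> gpoly al q j z = 0) ->
  (gpoly al p k z = 0 -> 0 < gpoly al f k z * gpoly al q k z) ->
  exists e d : R, [/\ 0 < e, 0 < d & forall t x, a <= t <= b -> `|z - t| < e ->
    0 < x -> x < d -> 0 <= gpoly al p 0 t + x * gpoly al q 0 t].
Proof.
move=> nf np zab of_ vp vq Hq.
have [pk0|pk0] := eqVneq (gpoly al p k z) 0.
  have [e e0 H] := same_sign_near nf zab of_ vq (Hq pk0).
  exists e, 1; split => // t x tab te x0 _; rewrite addr_ge0 ?np // mulr_ge0 ?H //.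
  exact: ltW.
have fp : 0 < gpoly al f k z * gpoly al p k z.
  by rewrite lt0r mulf_neq0 ?nonneg_compare //; case: of_.
set A := gpoly al f k z in fp *; set B := gpoly al p k z in fp *.
(* [d] is chosen such that [d * |A q_k|] stays below [A * B] *)
pose d := A * B / (1 + `|A * gpoly al q k z|).
have D0 : 0 < 1 + `|A * gpoly al q k z| by rewrite ltr_pwDl.
have d0 : 0 < d by rewrite divr_gt0.
pose h i := p i + d * q i.
have [||e e0 H] := @same_sign_near f h k z nf zab of_.
- by move=> j jk; rewrite gpoly_lin vp // vq // mulr0 addr0.
- rewrite gpoly_lin -/A -/B mulrDr mulrCA.
  set x := A * gpoly al q k z in d D0 d0 h *.
  have E : d * (1 + `|x|) = A * B by rewrite /d divfK // gt_eqF.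
  have : - (d * `|x|) <= d * x.
    by rewrite -mulrN ler_wpM2l ?(ltW d0) // lerNl -normrN ler_norm.
  by move: E; rewrite mulrDr mulr1; lra.
exists e, d; split => // t x tab te x0 xd.
have := H t tab te; rewrite gpoly_lin => H2.
have H1 := np t tab.
have -> : gpoly al p 0 t + x * gpoly al q 0 t = (1 - x / d) * gpoly al p 0 t +
   (x / d) * (gpoly al p 0 t + d * gpoly al q 0 t).
  by field; rewrite gt_eqF.
rewrite addr_ge0 // mulr_ge0 //.
  by rewrite subr_ge0 ler_pdivrMr // mul1r ltW.
by rewrite divr_ge0 // ltW.
Qed.

(** The local statements at all [z] are made uniform by compactness of [a, b]. *)
Lemma perturb_between f p q Z : nonneg f -> between f p -> zeros_exact_on al f a b Z ->
  vanish (gpoly al q) Z ->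
  (forall z, a <= z <= b -> let k := count_mem z Z in
     gpoly al p k z = 0 -> 0 < gpoly al f k z * gpoly al q k z) ->
  (forall z, a <= z <= b -> let k := count_mem z Z in
     gpoly al p k z = gpoly al f k z -> gpoly al f k z * gpoly al q k z < 0) ->
  exists2 x : R, 0 < x & between f (fun i => p i + x * q i).
Proof.
move=> nf fp ex vq H0 H1.
have [np nfp] := between_nonneg fp.
have L z : a <= z <= b -> exists e d : R, [/\ 0 < e, 0 < d & forall t x, a <= t <= b ->
    `|z - t| < e -> 0 < x -> x < d ->
    0 <= gpoly al p 0 t + x * gpoly al q 0 t <= gpoly al f 0 t].
  move=> zab; set k := count_mem z Z.
  have of_ := ex z zab.
  have vp := between_vanish fp zab of_.1.
  have vq' : forall j, (j < k)%N -> gpoly al q j z = 0 by move=> j; apply: vq.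
  have [e1 [d1 [e10 d10 P1]]] := perturb_nonneg_near nf np zab of_ vp vq' (H0 z zab).
  have [|||e2 [d2 [e20 d20 P2]]] := @perturb_nonneg_near f (fun i => f i - p i)
     (fun i => 0 - q i) k z nf nfp zab of_.
  - by move=> j jk; rewrite gpolyB vp // of_.1 // subrr.
  - by move=> j jk; rewrite gpolyB gpoly0 vq' // subrr.
  - rewrite !gpolyB gpoly0 sub0r mulrN oppr_gt0 => /eqP; rewrite subr_eq0 => /eqP E.
    by apply: H1.
  exists (Num.min e1 e2), (Num.min d1 d2); rewrite !lt_min e10 e20 d10 d20.
  split => // t x tab; rewrite !lt_min => /andP[te1 te2] x0 /andP[xd1 xd2].
  rewrite P1 //=; have := P2 t x tab te2 x0 xd2.
  by rewrite !gpolyB gpoly0 sub0r; lra.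
have /compact_near_coveringP/near_covering_withinP := @segment_compact R a b.
move=> /(_ R (0 : R)^'+
  (fun x t => 0 <= gpoly al p 0 t + x * gpoly al q 0 t <= gpoly al f 0 t)).
move=> /(_ _) H.
have {}H : \forall x \near (0 : R)^'+,
    `[a, b] `<=` (fun t => 0 <= gpoly al p 0 t + x * gpoly al q 0 t <= gpoly al f 0 t).
  apply: H => z /=; rewrite in_itv /= => zab.
  have [e [d [e0 d0 P]]] := L z zab.
  exists ([set t | `|z - t| < e], [set x | 0 < x < d]) => /=.
    split; first by apply/nbhs_ballP; exists e.
    near=> x; apply/andP; split; near: x; first exact: nbhs_right_gt.
    exact: nbhs_right_lt.
  move=> [t x] /= [te /andP[x0 xd]]; rewrite in_itv /= => tab.
  exact: (P t x tab te x0 xd).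
have [x [x0 xP]] : exists x : R, 0 < x /\
    `[a, b] `<=` (fun t => 0 <= gpoly al p 0 t + x * gpoly al q 0 t <= gpoly al f 0 t).
  near (0 : R)^'+ => x; exists x; split; first by near: x; exact: nbhs_right_gt.
  by near: x.
exists x => // t tab; rewrite gpoly_lin; apply: xP.
by rewrite /= in_itv.
Unshelve. all: by end_near.
Qed.

Let ev (t : R) (v : 'rV[R]_n.+1) : R := gpoly al (v ord0) 0 t.

Lemma ev_continuous t : continuous (ev t).
Proof.
rewrite (_ : ev t = \sum_i (fun v : 'rV[R]_n.+1 => v ord0 i * t `^ al i)); last first.
  by apply/funext => w; rewrite /ev gpolyE fct_sumE.
apply: (big_ind (fun g : 'rV[R]_n.+1 -> R => continuous g)) => [|g h gc hc|i _].
- exact: cst_continuous.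
- by move=> v; exact: (cvgD (gc v) (hc v)).
- move=> v; apply: (@continuous_comp _ _ _ (fun w : 'rV[R]_n.+1 => w ord0 i)
    (fun x : R => x * t `^ al i)).
    exact: (@coord_continuous R 1 n.+1 ord0 i v).
  exact: mulrr_continuous.
Qed.

(** The values at [n + 1] distinct points determine the coefficients through an
    invertible matrix, and these values are bounded by those of [f]. *)
Lemma value_bound f : exists B : R, forall u, between f u -> forall i, `|u i| <= B.
Proof.
pose pt (i : 'I_n.+1) : R := a + (b - a) * (i%:R / n.+1%:R).
have pt_ab i : a <= pt i <= b.
  have H : 0 <= (i%:R / n.+1%:R : R) <= 1.
    by rewrite divr_ge0 //= ler_pdivrMr // mul1r ler_nat ltnW.
  set r := i%:R / _ in H *; case/andP: H => r0 r1.
  have d0 : 0 <= (b - a) * r by rewrite mulr_ge0 // subr_ge0 ltW.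
  have d1 : (b - a) * r <= (b - a) * 1 by rewrite ler_wpM2l // subr_ge0 ltW.
  by rewrite /pt -/r; lra.
have pt_inj : injective pt.
  move=> i j /addrI/mulfI; rewrite subr_eq0 gt_eqF // => /(_ isT) H.
  apply: val_inj; apply/eqP; rewrite -(eqr_nat R).
  by rewrite -(inj_eq (@divIf _ n.+1%:R _)) ?H ?pnatr_eq0.
pose M : 'M[R]_n.+1 := \matrix_(i, j) pt i `^ al j.
have Mu : M \in unitmx.
  rewrite unitmxE unitfE; apply/negP; rewrite -det_tr => /det0P[v v0 vM].
  case/negP: v0; apply/eqP/rowP => i; rewrite mxE.
  apply: (@zero_count _ _ al (v ord0) [seq pt i | i <- enum 'I_n.+1]) => //.
  - by move=> z /mapP[j _ ->]; apply: pos_seg.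
  - move=> z j; rewrite count_uniq_mem; last by rewrite map_inj_uniq ?enum_uniq.
    case: mapP => // [[l _ ->]]; case: j => // _.
    move/matrixP: vM => /(_ ord0 l); rewrite mxE [RHS]mxE => E; rewrite -[RHS]E gpolyE.
    by apply: eq_bigr => j _; rewrite !mxE.
  - by rewrite size_map size_enum_ord.
exists (\sum_i \sum_j `|invmx M i j| * gpoly al f 0 (pt j)) => u fu i.
have -> : u i = \sum_j invmx M i j * gpoly al u 0 (pt j).
  pose U : 'cV[R]_n.+1 := \col_j u j.
  have E : invmx M *m (M *m U) = U by rewrite mulmxA mulVmx // mul1mx.
  have -> : u i = U i ord0 by rewrite mxE.
  rewrite -E mxE; apply: eq_bigr => j _; congr (_ * _).
  by rewrite gpolyE mxE; apply: eq_bigr => l _; rewrite !mxE mulrC.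
have T0 l j : 0 <= `|invmx M l j| * gpoly al f 0 (pt j).
  by rewrite mulr_ge0 //; have /andP[] := fu _ (pt_ab j); apply: le_trans.
apply: le_trans (ler_norm_sum _ _ _) _.
rewrite [X in _ <= X](bigD1 i) //= -[X in X <= _]addr0; apply: lerD; last first.
  by apply: sumr_ge0 => l _; apply: sumr_ge0 => j _.
apply: ler_sum => j _; rewrite normrM ler_wpM2l //.
by have /andP[u0 uf] := fu _ (pt_ab j); rewrite ger0_norm.
Qed.

Lemma extremal_between f (s c : R) : nonneg f ->
  exists2 p, between f p &
    forall u, between f u -> s * gpoly al u 0 c <= s * gpoly al p 0 c.
Proof.
move=> nf; have [B HB] := value_bound f.
pose K := [set v : 'rV[R]_n.+1 | between f (v ord0)].
have Kclosed : closed K.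
  have -> : K = \bigcap_(t in `[a, b])
      ([set v | 0 <= ev t v] `&` [set v | ev t v <= gpoly al f 0 t]).
    apply/seteqP; split => v /=.
      by move=> H t /=; rewrite in_itv /= => /H/andP.
    move=> H t tab; have := H t; rewrite /= in_itv /= => /(_ tab)[H1 H2].
    by rewrite H1.
  apply: closed_bigI => t _; apply: closedI.
    apply: (@closed_comp _ _ (ev t) [set x | 0 <= x]); last exact: closed_ge.
    by move=> v _; apply: ev_continuous.
  apply: (@closed_comp _ _ (ev t) [set x | x <= _]); last exact: closed_le.
  by move=> v _; apply: ev_continuous.
have Kcompact : compact K.
  apply: (@subclosed_compact _ _
    [set v : 'rV[R]_n.+1 | forall i, `[- B, B]%classic (v ord0 i)]) => //.
    apply: (@rV_compact R n.+1 (fun=> `[- B, B]%classic)) => _; exact: segment_compact.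
  move=> v /HB vB i /=; rewrite in_itv /=.
  by rewrite -ler_norml.
have K0 : K !=set0.
  exists 0 => t tab; rewrite (_ : gpoly _ _ _ _ = 0) ?lexx ?nf //.
  by rewrite /gpoly big1 // => i _; rewrite mxE mul0r.
have C : {within K, continuous (fun v => s * ev c v)}.
  apply: continuous_subspaceT => v.
  apply: (@continuous_comp _ _ _ (ev c) (fun x : R => s * x)).
    exact: ev_continuous.
  exact: mulrl_continuous.
have [v] := compact_EVT_max K0 Kcompact C.
rewrite inE => Kv H; exists (v ord0) => // u fu.
pose w : 'rV[R]_n.+1 := \row_i u i.
have E t : ev t w = gpoly al u 0 t.
  by apply: eq_bigr => i _; rewrite mxE.
have := H w; rewrite E; apply; rewrite inE /K /= => t tab.
by move: (E t); rewrite /ev => ->; apply: fu.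
Qed.

Lemma nabove_cat z W W' : nabove z (W ++ W') = (nabove z W + nabove z W')%N.
Proof. exact: count_cat. Qed.

(** Few points [w] cannot separate the points where [p] touches [0] from those
    where it touches [f] (in order relative to [f]).  Otherwise take [q] with
    zeros exactly [Z ++ w], padded to [n] zeros to the left of [a], and with the
    sign [(-1) ^+ count_mem b Z] at [c]: relative to [f] it is positive where an
    even number of points of [w] lies above and negative where this number is
    odd.  Then [p] plus a small multiple of [q] is still between [0] and [f],
    but beats [p] at [c].  The sign is needed since [f] itself may change sign
    at [b]. *)
Lemma no_separators f p Z w (c : R) : nonneg f -> zeros_exact_on al f a b Z ->
  (forall v, v \in Z -> a <= v <= b) -> b < c -> between f p ->
  (forall u, between f u ->
     (-1) ^+ count_mem b Z * gpoly al u 0 c <=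
     (-1) ^+ count_mem b Z * gpoly al p 0 c) ->
  (forall v, v \in w -> 0 < v < c) -> (size Z + size w <= n)%N ->
  (forall z, a <= z <= b -> let k := count_mem z Z in
     gpoly al p k z = 0 -> z \notin w /\ ~~ odd (nabove z w)) ->
  (forall z, a <= z <= b -> let k := count_mem z Z in
     gpoly al p k z = gpoly al f k z -> z \notin w /\ odd (nabove z w)) -> False.
Proof.
move=> nf ex Zab bc fp pmax wc sZw H0 H1.
set s := (-1) ^+ _ in pmax.
have ss : s * s = 1 by rewrite -expr2 sqrr_sign.
pose W := Z ++ w ++ nseq (n - (size Z + size w)) (a / 2).
have a2 : a / 2 < a by move: a_gt0; lra.
have W0 v : v \in W -> 0 < v.
  rewrite !mem_cat => /or3P[/Zab/pos_seg//|/wc/andP[]//|].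
  by rewrite mem_nseq => /andP[_ /eqP ->]; move: a_gt0 ltab bc a2; lra.
have sW : size W = n by rewrite !size_cat size_nseq addnA subnKC.
have [q0 exq0] := prescribed_zeros alI W0 sW.
have Wc v : v \in W -> v < c.
  rewrite !mem_cat => /or3P[/Zab/andP[_ vb]|/wc/andP[]//|].
    exact: le_lt_trans bc.
  by rewrite mem_nseq => /andP[_ /eqP ->]; move: a_gt0 ltab bc a2; lra.
have c0 : 0 < c by move: a_gt0 ltab bc; lra.
have nc : count_mem c W = 0%N.
  by apply/count_memPn/negP => /Wc; rewrite ltxx.
have nac : nabove c W = 0%N.
  apply/eqP; rewrite /nabove eqn0Ngt -has_count -all_predC; apply/allP => v /Wc vc /=.
  by rewrite -leNgt ltW.
pose x : R := s * Num.sg (gpoly al q0 0 c).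
have q0c : gpoly al q0 0 c != 0 by have [] := exq0 c c0; rewrite nc.
have sgq : Num.sg (gpoly al q0 0 c) * Num.sg (gpoly al q0 0 c) = 1.
  by rewrite -expr2 sqr_sg q0c.
have x0 : x != 0 by rewrite mulf_neq0 ?sgr_eq0 // signr_eq0.
pose q i := x * q0 i.
have exq z : 0 < z -> has_order (gpoly al q) (count_mem z W) z.
  move=> /exq0[v0 v1]; split; last by rewrite gpolyZ mulf_neq0.
  by move=> j jz; rewrite gpolyZ v0 // mulr0.
have sgs : Num.sg s = s by rewrite /s sgrX sgrN1.
have qc : Num.sg (gpoly al q 0 c) = s.
  by rewrite gpolyZ sgrM sgrM sgs sgr_id -mulrA sgq mulr1.
have csq z : a <= z <= b -> nsign al q W z = s.
  move=> zab; rewrite (@nsign_const _ _ al q z c W).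
  - by rewrite /nsign nc nac qc mulr1.
  - exact: pos_seg zab.
  - by case/andP: zab => _ zb; apply: le_trans (ltW bc).
  - by move=> t /andP[zt _]; apply: exq; apply: lt_le_trans (pos_seg zab) zt.
have key z : a <= z <= b -> z \notin w ->
    Num.sg (gpoly al f (count_mem z Z) z * gpoly al q (count_mem z Z) z) =
    (-1) ^+ nabove z w.
  move=> zab zw; have az2 : a / 2 < z by case/andP: zab => az _; lra.
  have kE : count_mem z W = count_mem z Z.
    rewrite !count_cat (count_memPn zw) count_nseq /= (lt_eqF az2) mul0n !addn0.
    by [].
  have nE : nabove z W = (nabove z Z + nabove z w)%N.
    rewrite !nabove_cat {3}/nabove count_nseq ltNge (ltW az2) mul0n addn0.
    by [].
  have := csq z zab; rewrite /nsign kE nE exprD => E1.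
  have zb v : v \in Z -> v <= b by case/Zab/andP.
  have := nonneg_nsign nf ex zb zab; rewrite /nsign -/s => E2.
  set A := Num.sg (gpoly al f _ z) in E2; set B := Num.sg (gpoly al q _ z) in E1.
  rewrite sgrM -/A -/B.
  set X := (-1) ^+ nabove z Z in E1 E2; set Y := (-1) ^+ nabove z w in E1 *.
  have XX : X * X = 1 by rewrite -expr2 sqrr_sign.
  have YY : Y * Y = 1 by rewrite -expr2 sqrr_sign.
  have : (B * (X * Y)) * (A * X) = 1 by rewrite E1 E2.
  have -> : (B * (X * Y)) * (A * X) = (A * B) * Y * (X * X) by ring.
  by rewrite XX mulr1 => E; rewrite -[LHS]mulr1 -YY mulrA E mul1r.
have [|||y y0 fpy] := @perturb_between f p q Z nf fp ex.
- move=> z j jz; have [z0|z0] := boolP (z \in Z); last first.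
    by rewrite (count_memPn z0) in jz.
  have [v _] := exq z (pos_seg (Zab z z0)); apply: v.
  by rewrite !count_cat; apply: ltn_addr.
- move=> z zab k /(H0 z zab)[zw ow]; rewrite -sgr_gt0 key //.
  by rewrite -signr_odd (negbTE ow).
- move=> z zab k /(H1 z zab)[zw ow]; rewrite -sgr_lt0 key //.
  by rewrite -signr_odd ow expr1 ltrN10.
have := pmax _ fpy; rewrite gpoly_lin mulrDr gerDl mulrCA pmulr_rle0 // leNgt.
by rewrite -sgr_gt0 sgrM sgs qc ss ltr01.
Qed.

End Nonneg.

(** * Separating alternating points *)

Section Separators.
Context {R : realType}.
Implicit Types (x y : R * bool) (s : seq (R * bool)) (c : R).

Fixpoint separators x s : seq R :=
  if s is y :: s' then
    (if x.2 == y.2 then [::] else [:: (x.1 + y.1) / 2]) ++ separators y s'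
  else [::].

Let lt1 x y := x.1 < y.1.

Lemma size_separators x s : (size (separators x s) <= size s)%N.
Proof.
elim: s x => [//|y s IH] x /=; rewrite size_cat.
by have := IH y; case: eqP => _ /=; lia.
Qed.

Lemma size_separators_eq x s : size (separators x s) = size s ->
  path (fun p q => p.2 != q.2) x s.
Proof.
elim: s x => [//|y s IH] x /=; rewrite size_cat.
case: eqP => /= _ H; last by apply: IH; lia.
by have := size_separators y s; lia.
Qed.

Lemma separators_bounds x s : path lt1 x s ->
  forall v, v \in separators x s -> x.1 < v < (last x s).1.
Proof.
elim: s x => [//|y s IH] x /= /andP[xy ys] v; rewrite /lt1 in xy.
have yl : y.1 <= (last y s).1.
  elim: s y ys {IH xy} => [//|z s IHs] y /= /andP[yz /IHs]; apply: le_trans.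
  exact: ltW.
rewrite mem_cat => /orP[|/(IH y ys)/andP[yv vl]]; last first.
  by rewrite vl andbT; apply: lt_trans yv.
case: eqP => // _; rewrite inE => /eqP ->.
by apply/andP; split; lra.
Qed.

(** Going left from the last point, the colour (second component) changes at each
    midpoint passed. *)
Lemma separators_parity x s : path lt1 x s -> forall y, y \in x :: s ->
  y.1 \notin separators x s /\
  odd (nabove y.1 (separators x s)) = (y.2 != (last x s).2).
Proof.
have all_above (z : R) (u : seq R) : (forall v, v \in u -> z < v) ->
    nabove z u = size u.
  by move=> H; apply/eqP; rewrite -all_count; apply/allP.
elim: s x => [|y s IH] x.
  by move=> _ y; rewrite inE => /eqP -> /=; rewrite eqxx.
move=> xys; have B := separators_bounds xys; move: xys.
move=> /= /andP[xy ys] z; rewrite /lt1 in xy.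
have By := separators_bounds ys.
have [_ Ey] := IH y ys y (mem_head _ _).
rewrite inE => /predU1P[->|zs].
  split; first by apply/negP => /B; rewrite ltxx.
  rewrite all_above; last by move=> v /B /andP[].
  rewrite size_cat oddD -(all_above y.1 (separators y s)); last by move=> v /By /andP[].
  by rewrite Ey; case: (x.2) (y.2) (last y s).2 => [] [] [].
have [H1 H2] := IH y ys z zs.
have yz : y.1 <= z.1.
  move: zs; rewrite inE => /predU1P[->//|zs].
  have tr : transitive lt1 by move=> ? ? ?; apply: lt_trans.
  by apply: ltW; apply: (allP (order_path_min tr ys)).
rewrite mem_cat negb_or H1 andbT nabove_cat -H2.
case: eqP => _ /=; first by [].
rewrite inE /nabove /= [_ < _](_ : _ = false) ?add0n; last first.
  by apply/negbTE; rewrite -leNgt; lra.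
by split => //; rewrite gt_eqF //; lra.
Qed.

Lemma path_le_last (z : R) (u : seq R) : path <=%R z u ->
  forall v, v \in z :: u -> v <= last z u.
Proof.
elim: u z => [|y u IH] z /=; first by move=> _ v; rewrite inE => /eqP ->.
move=> /andP[zy yu] v; rewrite inE => /predU1P[->|]; last exact: IH.
by apply: le_trans zy _; apply: IH (mem_head _ _).
Qed.

(** Zero lists and contact lists are taken of maximal size, so that an omitted
    zero or contact could be added; the zero bound limits their size. *)
Lemma max_list (Q : seq R -> Prop) M : Q [::] -> (forall u, Q u -> (size u <= M)%N) ->
  exists2 u, Q u & forall v, Q v -> (size v <= size u)%N.
Proof.
move=> Q0 QM; pose P k := `[< exists2 u, Q u & size u = k >].
have exP : exists k, P k by exists 0%N; apply/asboolP; exists [::].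
have bP k : P k -> (k <= M)%N by move=> /asboolP[u /QM + <-].
case: (ex_maxnP exP bP) => k /asboolP[u Qu <-] H.
by exists u => // v Qv; apply: H; apply/asboolP; exists v.
Qed.

Lemma finite_list (P : R -> Prop) M :
  (forall u, uniq u -> (forall z, z \in u -> P z) -> (size u <= M)%N) ->
  exists2 E : seq R, uniq E & forall z, z \in E <-> P z.
Proof.
move=> H.
have [||u [uu uP] umax] := @max_list (fun u => uniq u /\ forall z, z \in u -> P z) M.
- by split.
- by move=> u [uu uP]; apply: H.
exists u => // z; split; first exact: uP.
move=> Pz; apply/negPn/negP => zu.
have := umax (z :: u); rewrite /= ltnn => F; suff: false by []. apply: F.
split; first by rewrite zu.
by move=> y; rewrite inE => /predU1P[->//|/uP].
Qed.

End Separators.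

(** * Contact points *)

Section Contacts.
Context {R : realType} (a b : R).
Hypothesis ltab : a < b.
Implicit Types (E : seq R) (z : R).

(** The number of orders gained where a nonnegative function touches zero: two
    inside by parity, one at the ends. *)
Definition contact_mult z : nat := if a < z < b then 2%N else 1%N.
Definition contacts E : seq R := flatten [seq nseq (contact_mult z) z | z <- E].

Arguments contacts : simpl never.

Lemma contacts_cons z E : contacts (z :: E) = nseq (contact_mult z) z ++ contacts E.
Proof. by []. Qed.

Lemma count_contacts E z : uniq E ->
  count_mem z (contacts E) = if z \in E then contact_mult z else 0%N.
Proof.
elim: E => [//|y E IH] /= /andP[yE uE].
rewrite contacts_cons count_cat IH // count_nseq in_cons /=.
case: (eqVneq z y) => [->|zy] /=; first by rewrite (negbTE yE) mul1n addn0.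
by rewrite mul0n.
Qed.

Lemma mem_contacts E z : (z \in contacts E) = (z \in E).
Proof.
apply/flattenP/idP => [[_ /mapP[y yE ->]]|zE].
  by rewrite mem_nseq => /andP[_ /eqP ->].
exists (nseq (contact_mult z) z); first by apply/mapP; exists z.
by rewrite mem_nseq eqxx andbT /contact_mult; case: ifP.
Qed.

Lemma contacts_even E z : uniq E -> a < z < b -> ~~ odd (count_mem z (contacts E)).
Proof. by move=> uE zab; rewrite count_contacts // /contact_mult zab; case: ifP. Qed.

Lemma size_contacts_le E : (size E <= size (contacts E))%N.
Proof.
elim: E => [//|y E IH].
rewrite contacts_cons size_cat size_nseq [size (_ :: _)]/size -/size.
by rewrite -add1n leq_add // /contact_mult; case: ifP.
Qed.

Lemma size_contacts E : uniq E -> (forall z, z \in E -> a <= z <= b) ->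
  (size (contacts E) + ((a \in E) + (b \in E)) = 2 * size E)%N.
Proof.
elim: E => [//|y E IH] /andP[yE uE] H.
rewrite contacts_cons size_cat size_nseq !in_cons [size (_ :: _)]/size -/size.
have {}IH := IH uE (fun z zE => H z (mem_behead (s := y :: E) zE)).
have := H y (mem_head _ _); rewrite /contact_mult => /andP[].
rewrite !le_eqVlt => /predU1P[ay _|ay].
  subst y; rewrite ltxx /= eqxx (gt_eqF ltab) /= in IH *.
  by move: IH; rewrite (negbTE yE); lia.
move=> /predU1P[yb|yb].
  subst y; rewrite ltxx andbF eqxx (lt_eqF ltab) /= in IH *.
  by move: IH; rewrite (negbTE yE); lia.
by rewrite ay yb (lt_eqF ay) (gt_eqF yb) /= -addnA IH mulnS.
Qed.

End Contacts.

Section Core.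
Context {R : realType} {n : nat} (al : 'I_n.+1 -> R) (a b : R).
Hypotheses (alI : injective al) (a_gt0 : 0 < a) (ltab : a < b).
Implicit Types (f p : 'I_n.+1 -> R) (z t : R) (Z E W : seq R).

Lemma vanish_size f W : (exists i, f i != 0) -> (forall z, z \in W -> a <= z <= b) ->
  vanish (gpoly al f) W -> (size W <= n)%N.
Proof.
move=> [i fi] Wab van; rewrite leqNgt; apply/negP => H.
case/negP: fi; apply/eqP; apply: (zero_count alI _ van H).
by move=> z /Wab /(pos_seg a_gt0).
Qed.

Lemma zeros_exist f : (exists i, f i != 0) ->
  exists2 Z, (forall z, z \in Z -> a <= z <= b) & zeros_exact_on al f a b Z.
Proof.
move=> f0.
have [||Z [Zab van] Zmax] := @max_list R (fun W => (forall z, z \in W -> a <= z <= b) /\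
   vanish (gpoly al f) W) n.
- by split.
- by move=> W [Wab van]; apply: vanish_size van.
exists Z => // z zab; split; first by move=> j; apply: van.
apply/negP => /eqP g0; have := Zmax (z :: Z); rewrite /= ltnn => F.
suff: false by []. apply: F; split.
  by move=> w; rewrite inE => /predU1P[->//|/Zab].
move=> w j /=; case: eqVneq => [<-|_]; last exact: van.
by rewrite add1n ltnS leq_eqVlt => /predU1P[->//|/van].
Qed.

(** At an inner contact the first derivative to vanish beyond those of [f] has
    even order, so by nonnegativity of [p] the next one, of odd order, vanishes as
    well. *)
Lemma contacts_vanish f p Z E : nonneg al a b f -> between al a b f p ->
  zeros_exact_on al f a b Z -> (forall z, z \in Z -> a <= z <= b) -> uniq E ->
  (forall z, z \in E -> a <= z <= b /\ gpoly al p (count_mem z Z) z = 0) ->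
  vanish (gpoly al p) (Z ++ contacts a b E).
Proof.
move=> nf fp ex Zab uE EP z j; rewrite count_cat count_contacts //.
have [np _] := between_nonneg fp.
have vp y : a <= y <= b -> forall i, (i < count_mem y Z)%N -> gpoly al p i y = 0.
  by move=> yab; apply: (between_vanish a_gt0 ltab fp yab); case: (ex y yab).
case: ifP => [zE|_]; last first.
  rewrite addn0 => jz; apply: (vp _ _ _ jz); apply: Zab.
  by rewrite -has_pred1 has_count; apply: leq_ltn_trans jz.
have [zab pz] := EP z zE.
set k := count_mem z Z in pz *.
case: (ltngtP j k) => [jk _|kj|-> //]; first exact: vp.
rewrite /contact_mult; case: ifP => [zin jk|_]; last by lia.
have {kj jk} -> : j = k.+1 by lia.
apply/eqP/negP => /negP pk.
have ek : ~~ odd k := nonneg_even a_gt0 nf zin (ex z zab).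
have := @nonneg_even _ _ al a b a_gt0 p k.+1 z np zin.
rewrite /= negbK => H; case/negP: ek; apply: H; split => // i.
by rewrite ltnS leq_eqVlt => /predU1P[->//|]; apply: vp.
Qed.

End Core.

(** * The oscillating decomposition *)

Section Snake.
Context {R : realType} {n : nat} (al : 'I_n.+1 -> R) (a b : R).
Hypotheses (alI : injective al) (a_gt0 : 0 < a) (ltab : a < b).
Implicit Types (f p : 'I_n.+1 -> R) (z t : R) (Z E W : seq R).

(** Contacts are finitely many since each adds at least one zero of [p] to [Z]. *)
Lemma contact_list f p Z : nonneg al a b f -> between al a b f p ->
  zeros_exact_on al f a b Z -> (forall z, z \in Z -> a <= z <= b) ->
  (exists i, p i != 0) ->
  exists E, [/\ uniq E,
    forall z, z \in E <-> a <= z <= b /\ gpoly al p (count_mem z Z) z = 0,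
    vanish (gpoly al p) (Z ++ contacts a b E) &
    (size Z + size (contacts a b E) <= n)%N].
Proof.
move=> nf fp ex Zab p0.
have B E : uniq E ->
    (forall z, z \in E -> a <= z <= b /\ gpoly al p (count_mem z Z) z = 0) ->
    vanish (gpoly al p) (Z ++ contacts a b E) /\ (size Z + size (contacts a b E) <= n)%N.
  move=> uE EP; have van := contacts_vanish a_gt0 ltab nf fp ex Zab uE EP; split => //.
  rewrite -size_cat; apply: (@vanish_size _ _ _ a b alI a_gt0 p _ p0 _ van) => z.
  by rewrite mem_cat mem_contacts => /orP[/Zab//|/EP[]].
have [|E uE EP] := @finite_list R
  (fun z => a <= z <= b /\ gpoly al p (count_mem z Z) z = 0) n.
  move=> u uu uP; have [_ H] := B u uu uP.
  by apply: leq_trans (size_contacts_le a b u) _; apply: leq_trans (leq_addl _ _) H.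
have [|van sz] := B E uE; first by move=> z /EP.
by exists E.
Qed.

(** Let [E] collect the contact points of [p] with [0] ([E0]) and with [f]
    ([E1]), for [p] maximal at [c > b].  The separators between points of
    different kind, with [c] counted as a point of the first kind, number more
    than [n - size Z] by [no_separators] and at most [size E].  The zero bounds
    for [p] and [f - p] add up to [2 * size E <= 2 * (n - size Z) + 2], where the
    last summand is due to the end points.  Hence all these inequalities are
    equalities, which says that [E] alternates, contains [a] and [b], ends with
    a contact with [f], and that [p] and [f - p] have [n] zeros in [a, b]. *)
Lemma snake_decomposition f Z : nonneg al a b f -> zeros_exact_on al f a b Z ->
  (forall z, z \in Z -> a <= z <= b) -> (size Z < n)%N ->
  exists p E0 E1, [/\ between al a b f p,
    [/\ uniq E0, forall z, z \in E0 -> a <= z <= b,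
        vanish (gpoly al p) (Z ++ contacts a b E0) & size (Z ++ contacts a b E0) = n],
    [/\ uniq E1, forall z, z \in E1 -> a <= z <= b,
        vanish (gpoly al (fun i => f i - p i)) (Z ++ contacts a b E1) &
        size (Z ++ contacts a b E1) = n],
    b \in E1 & strictly_interlace a b (contacts a b E0) (contacts a b E1)].
Proof.
move=> nf ex Zab Zn.
pose c := b + 1; have bc : b < c by rewrite /c ltrDl.
have [p fp pmax] := extremal_between alI a_gt0 ltab ((-1) ^+ count_mem b Z) c nf.
have nosep := no_separators alI a_gt0 ltab nf ex Zab bc fp pmax.
have fk z : a <= z <= b -> gpoly al f (count_mem z Z) z != 0 by case/ex.
have aab : a <= a <= b by rewrite lexx ltW.
(* if p = 0 there are no contacts with f, and nothing has to be separated *)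
have p0 : exists i, p i != 0.
  apply: contrapT => /forallNP H.
  have pz j t : gpoly al p j t = 0.
    by rewrite /gpoly big1 // => i _; move/negP/negPn/eqP: (H i) => ->; rewrite mul0r.
  apply: (@nosep [::]) => //=; first by rewrite addn0 ltnW.
  by move=> z /fk; rewrite pz => + E; rewrite -E eqxx.
(* if p = f one point above b separates all contacts from c *)
have fp0 : exists i, f i - p i != 0.
  apply: contrapT => /forallNP H.
  have pz j t : gpoly al p j t = gpoly al f j t.
    apply/eqP; rewrite eq_sym -subr_eq0 -gpolyB; apply/eqP.
    by rewrite /gpoly big1 // => i _; move/negP/negPn/eqP: (H i) => ->; rewrite mul0r.
  apply: (@nosep [:: (b + c) / 2]) => /=.
  - by move=> v; rewrite inE => /eqP ->; move: a_gt0 ltab bc; lra.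
  - by rewrite addn1.
  - by move=> z /fk; rewrite pz => /eqP.
  - move=> z /andP[_ zb] _; have zc : z < (b + c) / 2 by move: bc zb; lra.
    by rewrite inE (lt_eqF zc) /nabove /= zc.
have fp' : between al a b f (fun i => f i - p i).
  by move=> t /fp/andP[H1 H2]; rewrite gpolyB subr_ge0 H2 gerBl H1.
have [E0 [uE0 E0P van0 sz0]] := contact_list nf fp ex Zab p0.
have [E1 [uE1 E1P' van1 sz1]] := contact_list nf fp' ex Zab fp0.
have E1P z : z \in E1 <-> a <= z <= b /\
    gpoly al p (count_mem z Z) z = gpoly al f (count_mem z Z) z.
  rewrite E1P' gpolyB; split=> -[zab /eqP H]; split=> //; apply/eqP;
    by rewrite ?subr_eq0 eq_sym // -subr_eq0 // in H *.
have E0ab z : z \in E0 -> a <= z <= b by case/E0P.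
have E1ab z : z \in E1 -> a <= z <= b by case/E1P.
have dis z : z \in E0 -> z \notin E1.
  move=> /E0P[zab z0]; apply/negP => /E1P[_]; rewrite z0 => z1.
  by have := fk z zab; rewrite -z1 eqxx.
have uE : uniq (E0 ++ E1).
  rewrite cat_uniq uE0 uE1 andbT; apply/hasPn => z zE1.
  by apply/negP => /dis; rewrite zE1.
pose E := sort <=%R (E0 ++ E1).
have memE z : (z \in E) = (z \in E0) || (z \in E1) by rewrite mem_sort mem_cat.
have Eab z : z \in E -> a <= z <= b by rewrite memE => /orP[/E0ab|/E1ab].
have Esort : sorted <%R E.
  by rewrite lt_sorted_uniq_le sort_uniq uE sort_sorted //; apply: le_total.
have sE : size E = (size E0 + size E1)%N by rewrite size_sort size_cat.
pose tag (z : R) := (z, z \in E1).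
have sc0 := size_contacts ltab uE0 E0ab; have sc1 := size_contacts ltab uE1 E1ab.
case EE : E => [|x s].
  have nE z : (z \in E0) = false /\ (z \in E1) = false.
    by have := memE z; rewrite EE /= in_nil; case: (z \in E0) (z \in E1) => [] [].
  exfalso; apply: (@nosep [::]) => //=; first by rewrite addn0 ltnW.
  move=> z zab z1; have zE1 : z \in E1 by apply/E1P.
  by have [_] := nE z; rewrite zE1.
have xs_path : path (fun u v : R * bool => u.1 < v.1) (tag x)
    (rcons (map tag s) (c, false)).
  rewrite rcons_path path_map /= last_map /=; apply/andP; split.
    by move: Esort; rewrite EE.
  apply: le_lt_trans bc; have lE : last x s \in E by rewrite EE mem_last.
  by case/andP: (Eab _ lE).
pose w := separators (tag x) (rcons (map tag s) (c, false)).
have sw : (size w <= size E)%N.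
  by apply: leq_trans (size_separators _ _) _; rewrite size_rcons size_map EE.
have wP z : z \in E -> z \notin w /\ odd (nabove z w) = (z \in E1).
  move=> zE; have := separators_parity xs_path (y := tag z); rewrite last_rcons /=.
  have -> : tag z \in tag x :: rcons (map tag s) (c, false).
    by rewrite -rcons_cons mem_rcons in_cons -map_cons -EE map_f ?orbT.
  by move=> /(_ isT)[H1 ->]; split => //; case: (z \in E1).
have nw : (n < size Z + size w)%N.
  rewrite ltnNge; apply/negP => wn; apply: (@nosep w) => //.
  - move=> v /(separators_bounds xs_path); rewrite last_rcons /= => /andP[xv ->].
    rewrite andbT.
    have xE : x \in E by rewrite EE mem_head.
    by apply: lt_trans xv; exact: (pos_seg a_gt0 (Eab x xE)).
  - move=> z zab k pk; have zE0 : z \in E0 by apply/E0P.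
    by have [|H1 ->] := wP z; rewrite ?memE ?zE0 //; split => //; apply: dis.
  - move=> z zab k pk; have zE1 : z \in E1 by apply/E1P.
    by have [|H1 ->] := wP z; rewrite ?memE ?zE1 ?orbT.
have in1 (y : R) : ((y \in E0) + (y \in E1) <= 1)%N.
  by have := dis y; case: (y \in E0) (y \in E1) => [] [] // /(_ isT).
have ina := in1 a; have inb := in1 b.
have [aE [bE [sz0' [sz1' swE]]]] :
  ((a \in E0) + (a \in E1) = 1 /\ (b \in E0) + (b \in E1) = 1 /\
   size Z + size (contacts a b E0) = n /\ size Z + size (contacts a b E1) = n /\
   size w = size E)%N.
  move: sc0 sc1 sz0 sz1 ina inb sw nw Zn; rewrite sE.
  move: (a \in E0 : nat) (a \in E1 : nat) (b \in E0 : nat) (b \in E1 : nat).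
  by clear; lia.
have alt : path (fun u v : R * bool => u.2 != v.2) (tag x)
    (rcons (map tag s) (c, false)).
  by apply: size_separators_eq; rewrite -/w swE EE size_rcons size_map.
move: alt; rewrite rcons_path last_map /= => /andP[alt].
have lastb : last x s = b.
  have bE' : b \in x :: s.
    by rewrite -EE memE; move: bE; case: (b \in E0) (b \in E1) => [] [].
  apply/eqP; rewrite eq_le; apply/andP; split.
    have lE : last x s \in E by rewrite EE mem_last.
    by case/andP: (Eab _ lE).
  apply: path_le_last bE'.
  by have := sort_sorted (@le_total _ R) (E0 ++ E1); rewrite -/E EE.
have heada : x = a.
  have aE' : a \in x :: s.
    by rewrite -EE memE; move: aE; case: (a \in E0) (a \in E1) => [] [].
  have /andP[ax _] : a <= x <= b by apply: Eab; rewrite EE mem_head.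
  apply/eqP; rewrite eq_le ax andbT; move: aE'; rewrite inE => /predU1P[->//|].
  move: Esort; rewrite EE /= => /(order_path_min lt_trans)/allP H /H; exact: ltW.
rewrite lastb /= => bE1; have {}bE1 : b \in E1 by move: bE1; case: (b \in E1).
exists p, E0, E1; split => //; try by split => //; rewrite size_cat.
exists (map tag (x :: s)); split.
- move=> z; rewrite mem_contacts; apply/mapP/idP => [[y + [-> /esym yE1]]|zE0].
    by rewrite -EE memE yE1 orbF.
  by exists z; rewrite -?EE ?memE ?zE0 // /tag (negbTE (dis _ zE0)).
- move=> z; rewrite mem_contacts; apply/mapP/idP => [[y _ [-> <-]]//|zE1].
  by exists z; rewrite -?EE ?memE ?zE1 ?orbT // /tag zE1.
- rewrite /= in alt *; move: xs_path; rewrite rcons_path => /andP[xs_path _].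
  elim: (map tag s) (tag x) alt xs_path => [//|y u IH] v /= /andP[-> ?] /andP[-> ?].
  exact: IH.
- by rewrite /= last_map lastb /tag bE1.
- move=> _ /=; rewrite heada /tag; case: (a \in E1); [by right|by left].
Qed.

End Snake.

(** * Assembly *)

Lemma count_mdiff (T : eqType) (s Z : seq T) z :
  count_mem z (mdiff s Z) = (count_mem z s - count_mem z Z)%N.
Proof.
elim: Z => [|y Z IH] /=; first by rewrite subn0.
by rewrite count_mem_rem IH; lia.
Qed.

Lemma mdiff_sort_cat (R : realType) (Z C : seq R) :
  perm_eq (mdiff (sort <=%R (Z ++ C)) Z) C.
Proof.
apply/allP => z _ /=; apply/eqP.
by rewrite count_mdiff count_sort count_cat addKn.
Qed.

Lemma interlace_perm (R : realType) (a b : R) (xs ys xs' ys' : seq R) :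
  perm_eq xs' xs -> perm_eq ys' ys ->
  strictly_interlace a b xs ys -> strictly_interlace a b xs' ys'.
Proof.
move=> px py [g [gx gy gs gl gh]]; exists g; split => //.
- by move=> z; rewrite gx (perm_mem px).
- by move=> z; rewrite gy (perm_mem py).
- move=> xs0; apply: gh; apply: contra_neq xs0 => xs0; move: px; rewrite xs0.
  by move/perm_nilP.
Qed.

Lemma sorted_last (R : realType) (b : R) (s : seq R) : sorted <=%R s -> b \in s ->
  (forall z, z \in s -> z <= b) -> last 0 s = b.
Proof.
case: s => [//|x s] /= srt bs le_b; apply/eqP; rewrite eq_le.
by rewrite le_b ?mem_last //= path_le_last.
Qed.

Section Assembly.
Context {R : realType} {n : nat} (al : 'I_n.+1 -> R) (a b : R).
Hypotheses (alI : injective al) (a_gt0 : 0 < a) (ltab : a < b).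
Implicit Types (f p : 'I_n.+1 -> R) (z t : R) (W : seq R).

Let F := fun (i : 'I_n.+1) (t : R) => t `^ al i.

(** A list of [n] zeros, sorted, is a list of nodes whose determinant represents
    every function with these zeros. *)
Lemma node_tuple W : size W = n -> (forall z, z \in W -> a <= z <= b) ->
  exists x : n.-tuple R, [/\ (x : seq R) = sort <=%R W,
    (forall z, z \in x -> a <= z <= b), sorted <=%R x &
    forall p, vanish (gpoly al p) W ->
      exists C, forall t, gpoly al p 0 t = C * \det (osc_mx F t x)].
Proof.
move=> sW Wab; have sx : size (sort <=%R W) == n by rewrite size_sort sW.
exists (Tuple sx); split => //=.
- by move=> z; rewrite memtE mem_sort; apply: Wab.
- by apply: sort_sorted; apply: le_total.
move=> p van; apply: vanish_osc_det => //.
  by move=> z; rewrite memtE mem_sort => /Wab /(pos_seg a_gt0).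
by apply: vanish_sub van => z /=; rewrite count_sort.
Qed.

Lemma zeros_exact_with_mult f Z : (forall z, z \in Z -> a <= z <= b) ->
  zeros_exact_on al f a b Z ->
  zeros_with_mult a b (gpoly al f 0) Z.
Proof.
move=> Zab ex; split => // z zab; have [v v'] := ex z zab.
have z0 := pos_seg a_gt0 zab.
by split=> [j jz|]; rewrite derive1n_gpoly // v.
Qed.

End Assembly.

Theorem theorem5p2p7 (R : realType) (a b : R) (n : nat) (alpha : 'I_n.+1 -> R)
    (f : R -> R) :
  let F := fun (i : 'I_n.+1) (t : R) => t `^ alpha i in
  0 < a -> a < b -> (0 < n)%N ->
  (forall i j : 'I_n.+1, (i < j)%N -> alpha i < alpha j) ->
  lin F f ->
  (forall t, a <= t <= b -> 0 <= f t) ->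
  exists (x y : n.-tuple R) (c_low c_up : R) (f_low f_up : R -> R),
    [/\ (forall z, z \in x -> a <= z <= b) /\ (forall z, z \in y -> a <= z <= b),
        sorted <=%R x /\ sorted <=%R y,
        last 0 y = b,
        [/\ lin F f_low, lin F f_up,
            (forall t, a <= t <= b -> 0 <= f_low t),
            (forall t, a <= t <= b -> 0 <= f_up t) &
            forall t, a <= t <= b ->
              [/\ f t = f_low t + f_up t,
                  f_low t = c_low * \det (osc_mx F t x) &
                  f_up t = c_up * \det (osc_mx F t y)]] &
        (exists t, a <= t <= b /\ f t != 0) ->
        exists Z : seq R,
          [/\ zeros_with_mult a b f Z,
              includes_mult Z x,
              includes_mult Z y \/ [/\ size Z = n, b \notin Z & c_up = 0],
              strictly_interlace a b (mdiff x Z) (mdiff y Z) &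
              even_groups_inside a b (mdiff x Z) /\
              even_groups_inside a b (mdiff y Z)]].
Proof.
move=> F a_gt0 ltab n0 alpha_lt [c fc] f_ge0.
have inj : injective alpha.
  move=> i j /eqP; case: (ltngtP i j) => [ij|ji|/val_inj//].
    by rewrite lt_eqF // alpha_lt.
  by rewrite gt_eqF // alpha_lt.
have fE (u : 'I_n.+1 -> R) : (fun t => \sum_(i < n.+1) u i * F i t) = gpoly alpha u 0.
  by apply/funext => t; rewrite gpolyE.
rewrite fE in fc; subst f.
have linE u : lin F (gpoly alpha u 0) by exists u; rewrite fE.
have bab : a <= b <= b by rewrite lexx ltW.
have nf : nonneg alpha a b c by [].
have [y0 [y0E y0ab y0s _]] := @node_tuple R n alpha a b inj a_gt0 (nseq n b)
  (size_nseq _ _) (fun z => ltac:(by rewrite mem_nseq => /andP[_ /eqP ->])).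
have y0b : last 0 y0 = b.
  apply: sorted_last => //; last by move=> z /y0ab/andP[].
  by rewrite y0E mem_sort mem_nseq n0 eqxx.
have g0 t : gpoly alpha (fun=> 0) 0 t = 0 by apply: gpoly0.
(* nodes for a zero summand: any list ending at b will do *)
have [c0|cn0] := pselect (forall i, c i = 0).
  have cE t : gpoly alpha c 0 t = 0 by rewrite /gpoly big1 // => i _; rewrite c0 mul0r.
  exists y0, y0, 0, 0, (gpoly alpha (fun=> 0) 0), (gpoly alpha (fun=> 0) 0).
  split => //.
    split => // t _; rewrite ?g0 // mul0r cE addr0; by split.
  by move=> [t [_]]; rewrite cE eqxx.
have {}cn0 : exists i, c i != 0.
  by apply: contrapT => /forallNP H; apply: cn0 => i; move/negP/negPn/eqP: (H i).
have [Z Zab Zex] := @zeros_exist R n alpha a b inj a_gt0 c cn0.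
have Zzero := zeros_exact_with_mult a_gt0 Zab Zex.
have vZ : vanish (gpoly alpha c) Z.
  move=> z j jz; have zZ : z \in Z.
    by rewrite -has_pred1 has_count; apply: leq_ltn_trans jz.
  by have [v _] := Zex z (Zab z zZ); apply: v.
have sZ : (size Z <= n)%N := @vanish_size R n alpha a b inj a_gt0 c Z cn0 Zab vZ.
move: sZ; rewrite leq_eqVlt => /predU1P[sZ|sZ].
  (* f has n zeros, so it is itself a determinant and the upper part is 0 *)
  have [x [xE xab xs xdet]] := node_tuple inj a_gt0 sZ Zab.
  have [C CE] := xdet c vZ.
  have dx : perm_eq (mdiff x Z) [::].
    by have := mdiff_sort_cat Z [::]; rewrite cats0 -xE.
  have incl : includes_mult Z x by move=> z; rewrite xE count_sort.
  have even0 (s : seq R) : perm_eq s [::] -> even_groups_inside a b s.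
    by move=> /permP E z _; rewrite E.
  have [bZ|bZ] := boolP (b \in Z).
    have xb : last 0 x = b.
      apply: sorted_last => //; last by move=> z /xab/andP[].
      by rewrite xE mem_sort.
    exists x, x, C, 0, (gpoly alpha c 0), (gpoly alpha (fun=> 0) 0).
    split => //.
      split => // t _; rewrite ?g0 // mul0r addr0; split => //; exact: CE.
    move=> _; exists Z; split => //; [by left| |by split; apply: even0].
    by apply: (interlace_perm dx dx); exists [::]; split.
  exists x, y0, C, 0, (gpoly alpha c 0), (gpoly alpha (fun=> 0) 0).
  split => //.
    split => // t _; rewrite ?g0 // mul0r addr0; split => //; exact: CE.
  have dy z : (z \in mdiff y0 Z) = (z == b).
    rewrite -has_pred1 has_count count_mdiff y0E count_sort count_nseq /= eq_sym.
    case: eqVneq => [->|_]; last by rewrite mul0n.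
    by rewrite (count_memPn bZ) mul1n subn0.
  move=> _; exists Z; split => //; [by right| |].
    exists [:: (b, true)]; split => //=.
    - by move=> z; rewrite inE xpair_eqE andbF (perm_mem dx).
    - by move=> z; rewrite inE xpair_eqE andbT dy.
    - by move=> H; case/negP: H; apply/eqP/perm_nilP.
  split; first exact: even0.
  move=> z /andP[_ zb]; rewrite (count_memPn _) // dy.
  by rewrite lt_eqF.
have [p [E0 [E1 [fp [uE0 E0ab van0 s0] [uE1 E1ab van1 s1] bE1 inter]]]] :=
  snake_decomposition inj a_gt0 ltab nf Zex Zab sZ.
have cab E : (forall z, z \in E -> a <= z <= b) ->
    forall z, z \in Z ++ contacts a b E -> a <= z <= b.
  by move=> Eab z; rewrite mem_cat mem_contacts => /orP[/Zab|/Eab].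
have [x [xE xab xs /(_ p van0)[C CE]]] := node_tuple inj a_gt0 s0 (cab _ E0ab).
have [y [yE yab ys /(_ _ van1)[D DE]]] := node_tuple inj a_gt0 s1 (cab _ E1ab).
have [np nq] := between_nonneg fp.
exists x, y, C, D, (gpoly alpha p 0), (gpoly alpha (fun i => c i - p i) 0).
have incl (E : seq R) (u : n.-tuple R) :
    (u : seq R) = sort <=%R (Z ++ contacts a b E) ->
    includes_mult Z u.
  by move=> -> z; rewrite count_sort count_cat leq_addr.
have dx := mdiff_sort_cat Z (contacts a b E0).
have dy := mdiff_sort_cat Z (contacts a b E1).
rewrite -xE in dx; rewrite -yE in dy.
split => //.
- apply: sorted_last => //; last by move=> z /yab/andP[].
  by rewrite yE mem_sort mem_cat mem_contacts bE1 orbT.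
- by split => // t tab; split; [rewrite gpolyB addrC subrK|exact: CE|exact: DE].
move=> _; exists Z; split => //; [exact: incl xE|by left; apply: incl yE| |].
  exact: interlace_perm dx dy inter.
by split=> z zab; [move/permP: dx => ->|move/permP: dy => ->]; apply: contacts_even.
Qed.
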